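(* Let $G$ be a Fitting group which is torsion-free or a $p$-group for some prime $p$. Assume that there exists a countable subset $X\subseteq G$ such that $G=X^G$. Then there exist a field $\mathbb F$, an $\mathbb F$-vector space $V$ and a series $\mathcal L$ in $V$ such that $G$ can be embedded (that is, there is an injective group homomorphism) into the Hirsch-Plotkin radical of $S(\mathcal L)$.
   Context: For a subset $X$ of a group $G$, $X^G$ denotes the normal closure of $X$ in $G$ (the subgroup generated by all conjugates of elements of $X$). A Fitting group is a group that is generated by its nilpotent normal subgroups; equivalently, the normal closure of every element is nilpotent. A series in an $\mathbb F$-vector space $V$ is a set $\mathcal L$ of subspaces of $V$, linearly ordered by inclusion, containing $0$ and $V$, such that for every $\mathcal F\subseteq\mathcal L$ both $\bigcap_{W\in\mathcal F}W$ and $\bigcup_{W\in\mathcal F}W$ belong to $\mathcal L$ (with the convention that the empty intersection is $V$ and the empty union is $0$). A jump of $\mathcal L$ is a pair $(B,T)$ of elements of $\mathcal L$ with $B<T$ and no element of $\mathcal L$ strictly between $B$ and $T$. Linear maps act on the right, and $[T,g]=T(g-1)$. The stability group of $\mathcal L$ is $S(\mathcal L)=\{g\in \mathrm{GL}(V,\mathbb F)\mid [T,g]\le B \text{ for every jump }(B,T)\text{ of }\mathcal L\}$. The Hirsch-Plotkin radical of a group is the subgroup generated by all its locally nilpotent normal subgroups. *)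

(* Defs.v *)
(* Groups and modules are those of MathComp; subgroups, subspaces and series
   are sets in the sense of mathcomp.classical. *)
From HB Require Import structures.
From mathcomp Require Import all_boot all_algebra all_classical.

Set Implicit Arguments.
Unset Strict Implicit.
Unset Printing Implicit Defensive.

Import GRing.Theory.
Local Open Scope classical_set_scope.

Section Groups.
Variable A : groupType.
Implicit Types (H K N X : set A) (p : nat).
Local Open Scope group_scope.

Definition subgroup H : Prop := group_closed [in H].

Definition generated X : set A := smallest subgroup X.

Definition normal_subgroup H N : Prop :=
  [/\ subgroup N, N `<=` H & forall x h, N x -> H h -> N (x ^ h)].

Definition normal_closure X : set A :=
  generated [set x ^ g | x in X & g in setT].

Definition commutator_subgroup K H : set A :=
  generated [set commg k h | k in K & h in H].

Fixpoint lower_central H (n : nat) : set A :=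
  if n is n'.+1 then commutator_subgroup (lower_central H n') H else H.

Definition nilpotent H : Prop := exists n, lower_central H n `<=` [set 1].

Definition locally_nilpotent H : Prop :=
  forall X, X `<=` H -> finite_set X -> nilpotent (generated X).

Definition hirsch_plotkin_radical H : set A :=
  generated (\bigcup_(N in [set N | normal_subgroup H N /\
                                    locally_nilpotent N]) N).

Definition fitting_group : Prop :=
  generated (\bigcup_(N in [set N | normal_subgroup setT N /\ nilpotent N]) N)
    = setT.

Definition torsion_free : Prop :=
  forall (x : A) (n : nat), (0 < n)%N -> x ^+ n = 1 -> x = 1.

Definition p_group p : Prop := forall x : A, exists n, x ^+ (p ^ n)%N = 1.

End Groups.

Arguments fitting_group : clear implicits.
Arguments torsion_free : clear implicits.
Arguments p_group : clear implicits.

Section GeneralLinearGroup.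
Variables (F : fieldType) (V : lmodType F).

Record GL : Type := MkGL {
  gl_fun :> V -> V;
  gl_inv : V -> V;
  gl_linear : linear gl_fun;
  gl_funK : cancel gl_fun gl_inv;
  gl_invK : cancel gl_inv gl_fun }.

HB.instance Definition _ (g : GL) :=
  GRing.isLinear.Build F V V *:%R (gl_fun g) (gl_linear g).

HB.instance Definition _ := gen_eqMixin GL.
HB.instance Definition _ := gen_choiceMixin GL.

Lemma gl_ext (g h : GL) : gl_fun g =1 gl_fun h -> g = h.
Proof.
case: g h => [f f' lf fK f'K] [g g' lg gK g'K] /= /funext fg; subst g.
have e : f' = g' by apply/funext => v; rewrite -{1}(g'K v) fK.
subst g'; congr MkGL; exact: Prop_irrelevance.
Qed.

Definition gl_one : GL :=
  @MkGL idfun idfun (fun _ _ _ => erefl) (fun _ => erefl) (fun _ => erefl).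

Lemma gl_mul_linear (g h : GL) : linear (h \o g).
Proof. by move=> a u v; rewrite /= !linearP. Qed.

(* Maps act on the right: v(gh) = (vg)h. *)
Definition gl_mul (g h : GL) : GL :=
  MkGL (gl_mul_linear g h) (can_comp (gl_funK h) (gl_funK g))
       (can_comp (gl_invK g) (gl_invK h)).

Lemma gl_inv_linear (g : GL) : linear (gl_inv g).
Proof.
by move=> a u v; rewrite -{1}(gl_invK g u) -{1}(gl_invK g v) -linearP gl_funK.
Qed.

Definition gl_inverse (g : GL) : GL :=
  MkGL (gl_inv_linear g) (gl_invK g) (gl_funK g).

Lemma gl_mulA : associative gl_mul.
Proof. by move=> f g h; apply: gl_ext. Qed.

Lemma gl_1mul : left_id gl_one gl_mul.
Proof. by move=> g; apply: gl_ext. Qed.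

Lemma gl_mul1 : right_id gl_one gl_mul.
Proof. by move=> g; apply: gl_ext. Qed.

Lemma gl_Vmul : left_inverse gl_one gl_inverse gl_mul.
Proof. by move=> g; apply: gl_ext => v /=; rewrite gl_invK. Qed.

Lemma gl_mulV : right_inverse gl_one gl_inverse gl_mul.
Proof. by move=> g; apply: gl_ext => v /=; rewrite gl_funK. Qed.

HB.instance Definition _ :=
  isGroup.Build GL gl_mulA gl_1mul gl_mul1 gl_Vmul gl_mulV.

End GeneralLinearGroup.

Section Series.
Variables (F : fieldType) (V : lmodType F).
Implicit Types (W B T : set V) (L : set (set V)).
Local Open Scope ring_scope.

Definition subspace W : Prop := submod_closed [in W].

(* The empty intersection is setT, i.e. V; the empty union is by convention
   the zero subspace rather than the empty set, so closure under unions is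
   only required of nonempty subfamilies. *)
Record is_series L : Prop := IsSeries {
  series_subspace : forall W, L W -> subspace W;
  series_total : forall W1 W2, L W1 -> L W2 -> W1 `<=` W2 \/ W2 `<=` W1;
  series_zero : L [set 0];
  series_full : L setT;
  series_bigcap : forall FF : set (set V), FF `<=` L -> L (\bigcap_(W in FF) W);
  series_bigcup : forall FF : set (set V), FF `<=` L -> FF !=set0 ->
    L (\bigcup_(W in FF) W) }.

Definition jump L B T : Prop :=
  [/\ L B, L T, B `<` T & forall W, L W -> ~ (B `<` W /\ W `<` T)].

(* [T, g] = T(g - 1) *)
Definition lin_commutator T (g : GL V) : set V := [set g t - t | t in T].

Definition stability_group L : set (GL V) :=
  [set g | forall B T, jump L B T -> lin_commutator T g `<=` B].

Lemma series_jump L v : is_series L -> v != 0 ->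
  exists B T, [/\ jump L B T, T v, ~ B v &
                 forall W, L W -> ~ W v -> W `<=` B].
Proof.
move=> sL v0.
exists (\bigcup_(W in [set W | L W /\ ~ W v]) W).
exists (\bigcap_(W in [set W | L W /\ W v]) W).
split; first (split).
- apply: (series_bigcup sL); first by move=> W [].
  exists [set 0]; split; first exact: series_zero sL.
  by move/eqP; rewrite (negbTE v0).
- by apply: (series_bigcap sL) => W [].
- split; last by move=> /(_ v) []; [move=> W [] | move=> W [_ nWv] /nWv].
  move=> w [W [LW nWv] Ww] W' [LW' W'v].
  by case: (series_total sL LW LW') => [|s]; [exact | case: nWv; exact: s].
- move=> W LW [[_ nWB] [_ nTW]]; have [Wv|nWv] := pselect (W v).
    by apply: nTW => w; apply.
  by apply: nWB => w Ww; exists W.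
- by move=> W [].
- by move=> [W [_ nWv] /nWv].
- by move=> W LW nWv w Ww; exists W.
Qed.

Lemma subspaceD W u v : subspace W -> W u -> W v -> W (u + v).
Proof.
by move=> [_ cW] /mem_set Wu /mem_set Wv; have := cW 1 u v Wu Wv;
  rewrite scale1r => /set_mem.
Qed.

Lemma subspaceN W u : subspace W -> W u -> W (- u).
Proof.
by move=> [W0 cW] /mem_set Wu; have := cW (-1) u 0 Wu W0;
  rewrite scaleN1r addr0 => /set_mem.
Qed.

Lemma stability_group_subgroup L : is_series L -> subgroup (stability_group L).
Proof.
move=> sL; split=> [|g h /set_mem Sg /set_mem Sh]; apply/mem_set => B T j.
  have [LB _ _ _] := j; move=> _ [t _ <-] /=.
  rewrite subrr; have [z _] := series_subspace sL LB; exact: set_mem z.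
have [LB LT [BT _] _] := j.
have sB := series_subspace sL LB; have sT := series_subspace sL LT.
move=> _ [t Tt <-] /=.
set s := gl_inv h (g t).
have Bgt : B (g t - t) by apply: Sg j _ _; exists t.
have Tgt : T (g t) by rewrite -(subrK t (g t)); apply: subspaceD => //; exact: BT.
have hs : h s = g t by rewrite /s gl_invK.
have Ts : T s.
  apply: contrapT => nTs.
  have s0 : s != 0.
    apply/eqP => s0; apply: nTs; rewrite s0; have [z _] := sT; exact: set_mem z.
  have [B' [T' [j' T's nB's]]] := series_jump sL s0.
  move=> /(_ _ LT nTs) TB'; apply: nB's.
  have [LB' _ _ _] := j'; have sB' := series_subspace sL LB'.
  have -> : s = g t + - (h s - s) by rewrite hs opprB addrCA subrr addr0.
  apply: subspaceD => //; first exact: TB'.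
  by apply: subspaceN => //; apply: Sh j' _ _; exists s.
have -> : s - t = - (h s - s) + (g t - t) by rewrite hs opprB addrA subrK.
apply: subspaceD => //; apply: subspaceN => //; apply: Sh j _ _; by exists s.
Qed.

End Series.

(* Main.v *)
Require Import Defs.
From mathcomp Require Import all_boot all_algebra all_classical.
From HB Require Import structures.
From mathcomp Require Import zify ring.

Set Implicit Arguments.
Unset Strict Implicit.
Unset Printing Implicit Defensive.

Import GRing.Theory.
Local Open Scope classical_set_scope.

(** The group [G] acts by left translation on functions [f : G -> F], where [F]
    is the field of rationals if [G] is torsion-free and the prime field if [G]
    is a [p]-group. The space [V] consists of polynomial functions, those killed
    by all sufficiently heavy iterated differences, and the task is to choose
    the weights so that every nilpotent normal piece of [G] acts unipotently on
    [V] while [V] still separates the elements of [G].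

    Weights. Since [X] is countable, [G] is the union of normal subgroups
    [N_0 <= N_1 <= ...] with [N_(k+1) = N_k * A_k], where [A_k] is nilpotent,
    normal, and in the second case of finite exponent ([fitting_sequence],
    [nilpotent_exponent]). On [N_k] there is a finite descending filtration [M]
    by normal subgroups of [G], where commutators add levels, with room to
    spare, and [p]-th powers multiply them by [p]; a word is heavy if its
    letters have levels of sum at least a bound [R]. Passing to [N_(k+1)]
    requires that [N_(k+1)] too moves each level deeper. So the factors of the
    filtration are subdivided into layers central in [N_(k+1)], the old levels
    are multiplied by a large number [q], and the layers fit into the gaps; the
    new part [N_(k+1) / N_k] goes below level [q] ([filtration_refine]). With
    [q] large enough, the words over [N_k] which are heavy stay the same. Hence
    a word of [R] letters from [N_k] kills [V], whatever happens later.

    Separation. The kernel [C] of the action is a subgroup; let [g <> 1] be an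
    element of [C] of highest level [s] in some [N_k]. Then [g] has infinite
    order, respectively order [p], modulo level [s.+1]: this is where [G] being
    torsion-free or a [p]-group enters. So [g] has a coordinate function, and it
    remains to extend polynomial functions from a subgroup [K] to all of [G]
    without making heavier differences nonzero. Zorn's lemma inside one level
    reduces this to adjoining a single element [t] ([extend_cyclic]), where the
    point is to control differences in the direction of [t]
    ([adjoin_polyP]). If no power of [t] lies in [K], the extension
    is constant along the powers of [t], and if [F] has characteristic [p] it is
    constant along runs of [p] powers; in characteristic zero, if [t ^+ n] lies in [K], one takes an [n]-th
    root of the unipotent operator of translation by [t ^+ n] ([extend_root]).

    Series. Each [N_k] acts unipotently on [V]. Refining [0 < V] successively
    by the fixed points of [N_0], [N_1], ... gives finite chains of submodules,
    each contained in the next. Any maximal chain [L] of subspaces containing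
    all of them is a series, and [N_k] stabilises a finite chain of members of
    [L]. The elements of [S(L)] stabilising a given finite chain of members of
    [L] form a nilpotent normal subgroup ([unipotent_embedding]). *)

(** * Subgroups and normal subgroups *)

Section Subgroups.
Variable G : groupType.
Implicit Types (H K N X Z : set G) (x y z g : G).
Local Open Scope group_scope.

Lemma subgroupP H : subgroup H <->
  [/\ H 1, forall x y, H x -> H y -> H (x * y) & forall x, H x -> H x^-1].
Proof.
split=> [sH|[H1 HM HV]].
  split; first exact/set_mem/(proj1 sH).
    by move=> x y /mem_set Hx /mem_set Hy; apply/set_mem/group_closedM.
  by move=> x /mem_set Hx; apply/set_mem/group_closedV.
split; first exact: mem_set.
by move=> x y /set_mem Hx /set_mem Hy; apply/mem_set/HM => //; exact: HV.
Qed.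

Lemma subgroup1 H : subgroup H -> H 1.
Proof. by move=> /subgroupP[]. Qed.

Lemma subgroupM H x y : subgroup H -> H x -> H y -> H (x * y).
Proof. by move=> /subgroupP[_ HM _]; exact: HM. Qed.

Lemma subgroupV H x : subgroup H -> H x -> H x^-1.
Proof. by move=> /subgroupP[_ _ HV]; exact: HV. Qed.

Lemma subgroupX H x n : subgroup H -> H x -> H (x ^+ n).
Proof.
move=> sH Hx; elim: n => [|n IHn]; first exact: subgroup1.
by rewrite expgS; apply: subgroupM.
Qed.

Lemma subgroupMr H x y : subgroup H -> H y -> H (x * y) -> H x.
Proof.
by move=> sH Hy Hxy; rewrite -(mulgK y x); apply: subgroupM => //; apply: subgroupV.
Qed.

Lemma generated_min H X : subgroup H -> X `<=` H -> generated X `<=` H.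
Proof. exact: smallest_sub. Qed.

Lemma sub_generated X : X `<=` generated X.
Proof. exact: sub_gen_smallest. Qed.

Lemma generated_subgroup X : subgroup (generated X).
Proof.
apply/subgroupP; split=> [H [sH _]|x y Hx Hy H HX|x Hx H HX].
- exact: subgroup1.
- by apply: subgroupM; [case: HX|exact: Hx|exact: Hy].
- by apply: subgroupV; [case: HX|exact: Hx].
Qed.

Lemma generatedS X Y : X `<=` Y -> generated X `<=` generated Y.
Proof.
move=> XY; apply: generated_min; first exact: generated_subgroup.
by move=> x /XY; exact: sub_generated.
Qed.

Local Notation normal N := (normal_subgroup setT N).

Lemma normal_subgroupP N : normal N <-> subgroup N /\ forall x g, N x -> N (x ^ g).
Proof.
split=> [[sN _ nN]|[sN nN]]; first by split=> // x g Nx; apply: nN.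
by split=> // x g Nx _; apply: nN.
Qed.

Lemma normal_sub N : normal N -> subgroup N.
Proof. by case. Qed.

Lemma normalJ N x g : normal N -> N x -> N (x ^ g).
Proof. by move=> /normal_subgroupP[_ nN]; exact: nN. Qed.

Lemma normalR N x g : normal N -> N x -> N [~ x, g].
Proof.
move=> nN Nx; rewrite commgEl; apply: (subgroupM (normal_sub nN)).
  exact: (subgroupV (normal_sub nN)).
exact: normalJ.
Qed.

Lemma normalRr N x g : normal N -> N x -> N [~ g, x].
Proof.
by move=> nN Nx; rewrite -invgR; apply: (subgroupV (normal_sub nN)); apply: normalR.
Qed.

Lemma generated_normal X :
  (forall x g, X x -> generated X (x ^ g)) -> normal (generated X).
Proof.
move=> XJ; apply/normal_subgroupP; split=> [|x g]; first exact: generated_subgroup.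
have sX := generated_subgroup X.
apply: (@generated_min [set x | generated X (x ^ g)]) x => [|x Xx].
  apply/subgroupP; split=> /= [|x y Hx Hy|x Hx].
  - by rewrite conj1g; apply: (subgroup1 sX).
  - by rewrite conjMg; apply: (subgroupM sX).
  - by rewrite conjVg; apply: (subgroupV sX).
exact: XJ.
Qed.

Lemma normal_closure_normal X : normal (normal_closure X).
Proof.
apply: generated_normal => _ g [x Xx [h _ <-]]; apply: sub_generated.
by exists x => //; exists (h * g) => //; rewrite conjgM.
Qed.

Lemma sub_normal_closure X : X `<=` normal_closure X.
Proof.
move=> x Xx; apply: sub_generated; exists x => //.
by exists 1 => //; rewrite conjg1.
Qed.

Lemma normal_closure_min X N : normal N -> X `<=` N -> normal_closure X `<=` N.
Proof.
move=> nN XN; apply: generated_min; first exact: normal_sub.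
by move=> _ [x Xx [g _ <-]]; apply: normalJ => //; exact: XN.
Qed.

Lemma setM_normal N A : normal N -> normal A ->
  normal [set x | exists u v, [/\ N u, A v & x = u * v]].
Proof.
move=> nN nA; have [sN sA] := (normal_sub nN, normal_sub nA).
apply/normal_subgroupP; split=> [|_ g [u [v [Nu Av ->]]]]; last first.
  by exists (u ^ g), (v ^ g); rewrite conjMg;
    split=> //; [apply: (normalJ _ nN)|apply: (normalJ _ nA)].
apply/subgroupP; split.
- by exists 1, 1; split; [exact: subgroup1 sN|exact: subgroup1 sA|rewrite mulg1].
- move=> _ _ [u [v [Nu Av ->]]] [u' [v' [Nu' Av' ->]]].
  exists (u * u' ^ v^-1), (v * v'); split.
  + by apply: (subgroupM sN) => //; apply: (normalJ _ nN).
  + exact: (subgroupM sA).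
  + by rewrite /conjg; rewrite ?gnorm.
- move=> _ [u [v [Nu Av ->]]]; exists (u^-1 ^ v), (v^-1); split.
  + by apply: (normalJ _ nN); apply: (subgroupV sN).
  + exact: (subgroupV sA).
  + by rewrite /conjg; rewrite ?gnorm.
Qed.

(** Congruence modulo a normal subgroup stands in for the quotient group. *)
Definition cong Z x y := Z (x^-1 * y).

Section Congruence.
Variable Z : set G.
Hypothesis nZ : normal Z.
Let sZ := normal_sub nZ.

Lemma cong_refl x : cong Z x x.
Proof. by rewrite /cong mulVg; apply: subgroup1. Qed.

Lemma cong_sym x y : cong Z x y -> cong Z y x.
Proof. by move=> /(subgroupV sZ); rewrite /cong invgM invgK. Qed.

Lemma cong_trans y x z : cong Z x y -> cong Z y z -> cong Z x z.
Proof. by move=> xy yz; have := subgroupM sZ xy yz; rewrite /cong; rewrite ?gnorm. Qed.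

Lemma congM x y x' y' : cong Z x x' -> cong Z y y' -> cong Z (x * y) (x' * y').
Proof.
move=> xx' yy'; rewrite /cong.
have -> : (x * y)^-1 * (x' * y') = (x^-1 * x') ^ y * (y^-1 * y').
  by rewrite /conjg; rewrite ?gnorm.
by apply: subgroupM => //; apply: normalJ.
Qed.

Lemma cong_in x y : cong Z x y -> Z y -> Z x.
Proof.
move=> /cong_sym xy Zy; have := subgroupM sZ Zy xy.
by rewrite /cong; rewrite ?gnorm.
Qed.

Lemma cong_mulr x z : Z z -> cong Z (x * z) x.
Proof. by move=> Zz; rewrite /cong ?gnorm; apply: (subgroupV sZ). Qed.

Lemma cong_expgMn x y n : Z [~ x, y] ->
  cong Z ((x * y) ^+ n) (x ^+ n * y ^+ n).
Proof.
move=> Zxy.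
have yx : cong Z (y * x) (x * y).
  by rewrite /cong (commgC x y) (mulgA _ (y * x)) mulVg mul1g.
have ynx k : cong Z (y ^+ k * x) (x * y ^+ k).
  elim: k => [|k IHk]; first by rewrite !expg0 mul1g mulg1; apply: cong_refl.
  rewrite !expgS -mulgA; apply: (cong_trans (congM (cong_refl y) IHk)).
  by rewrite !mulgA; apply: congM => //; apply: cong_refl.
elim: n => [|n IHn]; first by rewrite !expg0 mulg1; apply: cong_refl.
rewrite expgSr; apply: (cong_trans (congM IHn (cong_refl _))).
rewrite mulgA -(mulgA (x ^+ n)) [x ^+ n.+1]expgSr [y ^+ n.+1]expgSr !mulgA.
apply: congM; last exact: cong_refl.
by rewrite -!mulgA; apply: congM; [apply: cong_refl|apply: ynx].
Qed.

Lemma cong_powM_in x y n : Z [~ x, y] -> Z (x ^+ n) -> Z (y ^+ n) ->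
  Z ((x * y) ^+ n).
Proof.
by move=> Zxy Zx Zy; apply: (cong_in (cong_expgMn n Zxy)); apply: subgroupM.
Qed.

End Congruence.

Lemma commgMJl x y z : [~ x * y, z] = [~ x, z] ^ y * [~ y, z].
Proof. by rewrite /commg /conjg; rewrite ?gnorm. Qed.

Lemma commgMJr x y z : [~ x, y * z] = [~ x, z] * [~ x, y] ^ z.
Proof. by rewrite /commg /conjg; rewrite ?gnorm. Qed.

Lemma commgVJl x y : [~ x^-1, y] = [~ x, y]^-1 ^ x^-1.
Proof. by rewrite /commg /conjg; rewrite ?gnorm. Qed.

Lemma commgVJr x y : [~ x, y^-1] = [~ x, y]^-1 ^ y^-1.
Proof. by rewrite /commg /conjg; rewrite ?gnorm. Qed.

(** * Lower central series *)

Lemma lower_centralS H n : subgroup H -> lower_central H n.+1 `<=` lower_central H n.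
Proof.
move=> sH; elim: n => [|n IHn] /=; last first.
  by apply: generatedS => _ [x Hx [y Hy <-]]; exists x => //; [exact: IHn|exists y].
apply: generated_min => // _ [x Hx [y Hy <-]].
by apply: subgroupM; [|apply: subgroupV|rewrite /conjg; do ?apply: subgroupM => //;
  apply: subgroupV].
Qed.

Lemma lower_central_sub H K n : H `<=` K -> lower_central H n `<=` lower_central K n.
Proof.
move=> HK; elim: n => [//|n IHn] /=.
by apply: generatedS => _ [x Hx [y Hy <-]]; exists x; [exact: IHn|exists y; [exact: HK|]].
Qed.

Lemma nilpotentS H K : H `<=` K -> nilpotent K -> nilpotent H.
Proof. by move=> HK [n Kn]; exists n => x /(lower_central_sub HK)/Kn. Qed.

Lemma lower_central_normal H n : normal H -> normal (lower_central H n).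
Proof.
move=> nH; elim: n => [//|n IHn]; apply: generated_normal => _ g [x Hx [y Hy <-]].
apply: sub_generated; exists (x ^ g); first exact: normalJ.
by exists (y ^ g); [exact: normalJ|rewrite -conjRg].
Qed.

Lemma lower_central_commg H n x y :
  lower_central H n x -> H y -> lower_central H n.+1 [~ x, y].
Proof. by move=> Hx Hy; apply: sub_generated; exists x => //; exists y. Qed.

(** Each factor of the lower central series of a group generated by elements
    of exponent [n] is an abelian group generated by elements of exponent [n],
    because modulo the next term commutators are additive in both arguments. *)
Lemma lower_central_expg Y n j : normal (generated Y) ->
  (forall y, Y y -> y ^+ n = 1) ->
  forall x, lower_central (generated Y) j x ->
    lower_central (generated Y) j.+1 (x ^+ n).
Proof.
set A := generated Y => nA Yn.
have nL i := lower_central_normal i nA.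
have sL i := normal_sub (nL i).
have sA := normal_sub nA.
have LS i := @lower_centralS A i sA.
have abelianL i x y : lower_central A i x -> lower_central A i y ->
    lower_central A i.+1 [~ x, y].
  move=> Lx Ly; apply: lower_central_commg => //.
  by elim: {x Lx} i Ly => // i IHi /LS.
have sub_pow i : subgroup [set x | lower_central A i x /\
                                    lower_central A i.+1 (x ^+ n)].
  apply/subgroupP; split=> [|x y [Lx Lxn] [Ly Lyn]|x [Lx Lxn]].
  - by split; [|rewrite expg1n]; apply: (subgroup1 (sL _)).
  - split; first exact: subgroupM.
    by apply: (cong_powM_in (nL _)) => //; exact: abelianL.
  - by split; [|rewrite expVgn]; apply: (subgroupV (sL _)).
case: j => [|j] x Lx.
  apply: (proj2 (generated_min (sub_pow 0%N) (X := Y) _ Lx)).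
  by move=> y Yy; split; [exact: sub_generated|rewrite Yn //; apply: subgroup1].
apply: (proj2 (generated_min (sub_pow j.+1)
  (X := [set commg k h | k in lower_central A j & h in A]) _ Lx)).
move=> _ [u Lu [v Av <-]]; split; first exact: lower_central_commg.
have Luv w : A w -> lower_central A j.+1 [~ u, w] by apply: lower_central_commg.
apply: (proj2 (@generated_min
  [set v | A v /\ lower_central A j.+2 ([~ u, v] ^+ n)] Y _ _ v Av)); last first.
  move=> y Yy; split; first exact: sub_generated.
  have uyk k : cong (lower_central A j.+2) ([~ u, y ^+ k]) ([~ u, y] ^+ k).
    elim: k => [|k IHk]; first by rewrite commg1; apply: (cong_refl (nL _)).
    rewrite expgS expgSr commgMJr; apply: (congM (nL _)) => //.
    rewrite (_ : [~ u, y] ^ (y ^+ k) = [~ u, y] * [~ [~ u, y], y ^+ k]).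
      by apply: (cong_mulr (nL _)); apply: lower_central_commg;
        [apply: Luv; apply: sub_generated|apply: (subgroupX _ sA); apply: sub_generated].
    by rewrite /commg /conjg; rewrite ?gnorm.
  apply: (cong_in (nL _) (cong_sym (nL _) (uyk n))).
  by rewrite Yn // commg1; apply: (subgroup1 (sL _)).
apply/subgroupP; split=> [|v1 v2 [A1 L1] [A2 L2]|v1 [A1 L1]].
- by split; [exact: subgroup1 sA|rewrite commg1 expg1n; exact: (subgroup1 (sL _))].
- split; first exact: (subgroupM sA).
  rewrite commgMJr; apply: (cong_powM_in (nL _)) => //.
    by apply: abelianL; [apply: Luv|apply: (normalJ _ (nL _)); apply: Luv].
  by rewrite -conjXg; apply: (normalJ _ (nL _)).
- split; first exact: (subgroupV sA).
  rewrite commgVJr -conjXg; apply: (normalJ _ (nL _)).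
  by rewrite expVgn; apply: (subgroupV (sL _)).
Qed.

Lemma nilpotent_exponent Y n : normal (generated Y) -> nilpotent (generated Y) ->
  (forall y, Y y -> y ^+ n = 1) ->
  exists c, forall x, generated Y x -> x ^+ (n ^ c) = 1.
Proof.
move=> nA [c Ac] Yn; exists c => x Ax; apply: Ac.
elim: c => [|c IHc]; first by rewrite expn0 expg1.
by rewrite expnS mulnC expgnA; apply: lower_central_expg.
Qed.

End Subgroups.

Notation normal N := (normal_subgroup setT N).

(** * Filtrations and their refinement *)

Section Filtrations.
Variable G : groupType.
Implicit Types (M : nat -> set G) (l : seq G).
Local Open Scope group_scope.

(** The extra step in [fil_comm] and [fil_pow] is the room in which a later
    refinement places its layers. In the torsion-free case [p] is [0], and then
    [fil_pow] holds trivially. *)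
Record filtration (p : nat) M (R : nat) : Prop := Filtration {
  fil_normal : forall i, normal (M i);
  fil_desc : forall i, M i.+1 `<=` M i;
  fil_comm : forall i j x y, (0 < i)%N -> (0 < j)%N ->
    M i x -> M j y -> M (i + j).+1 [~ x, y];
  fil_pow : forall i x, (0 < i)%N -> M i x -> M (p * i).+1 (x ^+ p);
  fil_last : M R `<=` [set 1];
  fil_gt0 : (0 < R)%N }.

(** The letters of [l] have positive levels whose sum is at least [r]; the
    truncated subtraction turns this into an exact count down to zero. *)
Fixpoint heavy M (r : nat) l : Prop :=
  if l is x :: l' then exists2 j, (0 < j)%N & M j x /\ heavy M (r - j) l'
  else r = 0%N.

Lemma fil_le p M R i j : filtration p M R -> (i <= j)%N -> M j `<=` M i.
Proof.
move=> fM; elim: j => [|j IHj]; first by case: i => // _ x.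
by rewrite leq_eqVlt => /predU1P[-> x|/IHj Mji x /(fil_desc fM)/Mji].
Qed.

(** An upper central series between [B] and [T] relative to [C], with the
    additional demand that [p]-th powers descend as well. *)
Fixpoint layer (p : nat) (C B T : set G) (e : nat) : set G :=
  if e is e'.+1 then
    [set x | [/\ T x, layer p C B T e' (x ^+ p) &
                 forall y, C y -> layer p C B T e' [~ x, y]]]
  else B.

Section Layers.
Variables (p : nat) (C B T : set G).
Hypotheses (nC : normal C) (nB : normal B) (nT : normal T).
Hypotheses (BT : B `<=` T) (TC : T `<=` C).
Local Notation Z := (layer p C B T).

Lemma layer_sub e : Z e `<=` T.
Proof. by case: e => [|e] //= x []. Qed.

Lemma layer_normal e : normal (Z e).
Proof.
elim: e => [//|e nZ]; have sZ := normal_sub nZ.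
have sT := normal_sub nT.
apply/normal_subgroupP; split; last first.
  move=> x g [Tx Zxp Zx]; split; first exact: (normalJ _ nT).
    by rewrite -conjXg; apply: (normalJ _ nZ).
  move=> y Cy; rewrite -(conjgKV g y) -conjRg; apply: (normalJ _ nZ); apply: Zx.
  exact: (normalJ _ nC).
apply/subgroupP; split=> [|x y [Tx Zxp Zx] [Ty Zyp Zy]|x [Tx Zxp Zx]].
- split; first exact: (subgroup1 sT).
    by rewrite expg1n; exact: (subgroup1 sZ).
  by move=> y _; rewrite comm1g; exact: (subgroup1 sZ).
- split; first exact: (subgroupM sT).
    by apply: (cong_powM_in nZ) => //; apply: Zx; exact: TC.
  move=> z Cz; rewrite commgMJl; apply: (subgroupM sZ); last exact: Zy.
  by apply: (normalJ _ nZ); exact: Zx.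
- split; first exact: (subgroupV sT).
    by rewrite expVgn; exact: (subgroupV sZ).
  move=> y Cy; rewrite commgVJl; apply: (normalJ _ nZ); apply: (subgroupV sZ).
  exact: Zx.
Qed.

Lemma layerS e : Z e `<=` Z e.+1.
Proof.
elim: e => [|e IHe] x.
  move=> Bx; split; [exact: BT| exact: (subgroupX _ (normal_sub nB))|].
  by move=> y _; apply: normalR.
by move=> [Tx Zxp Zx]; split=> // [|y Cy]; [exact: IHe|apply: IHe; exact: Zx].
Qed.

Lemma layer_le e e' : (e <= e')%N -> Z e `<=` Z e'.
Proof.
elim: e' => [|e' IHe]; first by case: e => // _ x.
by rewrite leq_eqVlt => /predU1P[-> x|/IHe Zee x /Zee/layerS].
Qed.

Variables (N A : set G) (c a : nat).
Hypotheses (nN : normal N) (nA : normal A) (AC : A `<=` C).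
Hypothesis CNA : forall y, C y -> exists u v, [/\ N u, A v & y = u * v].
Hypothesis TN : forall x u, T x -> N u -> B [~ x, u].
Hypothesis Ac : lower_central A c `<=` [set 1].
Hypothesis Aa : forall v, A v -> v ^+ (p ^ a) = 1.

(** An element of [A] is pushed deeper into the lower central series of [A] by
    commutators and loses order by taking powers; [N] acts trivially. *)
Lemma layer_lower_central n j k z : ((c - j) * a.+1 + k <= n)%N ->
  lower_central A j z -> T z -> z ^+ (p ^ k) = 1 -> Z n z.
Proof.
have sA := normal_sub nA.
elim: n j k z => [|n IHn] j k z le_n Az Tz zk.
  have k0 : k = 0%N by move: le_n; rewrite leqn0 addn_eq0 => /andP[_ /eqP].
  by move: zk; rewrite k0 expn0 expg1 => ->; apply: (subgroup1 (normal_sub nB)).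
have sZ := normal_sub (layer_normal n).
have LA i : lower_central A i `<=` A.
  by elim: i => // i IHi x /(lower_centralS sA)/IHi.
have [cj|jc] := leqP c j.
  suff -> : z = 1 by exact: (subgroup1 (normal_sub (layer_normal n.+1))).
  apply: Ac; have {}Az : lower_central A (c + (j - c)) z by rewrite subnKC.
  by elim: (j - c) Az => [|i IHi]; rewrite ?addn0 // addnS => /(lower_centralS sA).
split=> //.
  case: k => [|k] in le_n zk *.
    by move: zk; rewrite expn0 expg1 => ->; rewrite expg1n; apply: (subgroup1 sZ).
  apply: (IHn j k) => //; first by lia.
  - exact: (subgroupX _ (normal_sub (lower_central_normal j nA))).
  - exact: (subgroupX _ (normal_sub nT)).
  - by rewrite -expgnA -expnS.
move=> y /CNA[u [v [Nu Av ->]]]; rewrite commgMJr; apply: (subgroupM sZ); last first.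
  by apply: (normalJ _ (layer_normal n)); apply: (layer_le (leq0n n)); exact: TN.
have Ajzv : lower_central A j.+1 [~ z, v] by apply: lower_central_commg.
apply: (IHn j.+1 a) => //; [nia|exact: normalR|].
by apply: Aa; apply: LA Ajzv.
Qed.

(** The first alternative is the case of the new factor on top, the second one
    that of an old factor, where [N] and taking powers already act trivially. *)
Lemma layer_full : (forall x, T x -> exists u v, [/\ B u, A v & x = u * v]) \/
    (forall x, T x -> B (x ^+ p)) ->
  T `<=` Z (c * a.+1 + a).+1.
Proof.
set E0 := (_ + a)%N.
have ZA v : A v -> T v -> Z E0 v.
  move=> Av Tv; apply: (@layer_lower_central _ 0 a) => //; last exact: Aa.
  by rewrite subn0.
have sZ := normal_sub (layer_normal E0).
move=> TT x Tx; case: TT => [TT|Tp].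
  have [u [v [Bu Av xuv]]] := TT _ Tx; apply: layerS; rewrite xuv.
  apply: (subgroupM sZ); first exact: (layer_le (leq0n E0)).
  apply: ZA => //; rewrite -(mulKg u v) -xuv.
  by apply: (subgroupM (normal_sub nT)) => //; apply: (subgroupV (normal_sub nT)); exact: BT.
split=> //; first by apply: (layer_le (leq0n E0)); exact: Tp.
move=> y /CNA[u [v [Nu Av ->]]]; rewrite commgMJr; apply: (subgroupM sZ); last first.
  by apply: (normalJ _ (layer_normal E0)); apply: (layer_le (leq0n E0)); exact: TN.
by apply: ZA; [exact: normalRr|exact: normalR].
Qed.

End Layers.

(** The layer [e] of the factor [T i / M i.+1] receives the weight [wt i e].
    In the old factors the weights are spaced by [g], which exceeds the weight
    of every element of the new factor [C / M 1], so commutators with the latter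
    fit. In the new factor, where both entries of a commutator may lie, the
    weights are powers of [b]. *)
Section Refinement.
Variables (p : nat) (M : nat -> set G) (R : nat) (A : set G) (c a : nat).
Hypotheses (fM : filtration p M R) (nA : normal A).
Hypothesis Ac : lower_central A c `<=` [set 1].
Hypothesis Aa : forall v, A v -> v ^+ (p ^ a) = 1.

Let C : set G := [set x | exists u v, [/\ M 1 u, A v & x = u * v]].
Let T i : set G := if i is 0 then C else M i.
Let E := (c * a.+1 + a).+1.
Let b := (p + 3)%N.
Let g := (b ^ E).+1.
Let q := (g * E * (p + R + 3)).+1.
Let Z i : nat -> set G := layer p C (M i.+1) (T i).
Let wt i e : nat := if i is 0 then b ^ (E - e) else q * i + g * (E - e).
Let M' j : set G :=
  [set x | exists i e, [/\ (0 < e <= E)%N, (j <= wt i e)%N & Z i e x]].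

Let nM i : normal (M i). Proof. exact: fil_normal fM i. Qed.
Let nC : normal C. Proof. exact: setM_normal. Qed.
Let nT i : normal (T i).
Proof. by case: i => [|i]; [exact: nC|exact: nM]. Qed.
Let AC : A `<=` C.
Proof.
move=> v Av; exists 1, v; rewrite mul1g; split=> //.
exact: (subgroup1 (normal_sub (nM 1))).
Qed.
Let M1C : M 1 `<=` C.
Proof.
move=> u Mu; exists u, 1; rewrite mulg1; split=> //.
exact: (subgroup1 (normal_sub nA)).
Qed.
Let TC i : T i `<=` C.
Proof. by case: i => [|i] x // Mx; apply: M1C; apply: (fil_le fM _ Mx). Qed.
Let MT i : M i.+1 `<=` T i.
Proof. by case: i => [|i]; [exact: M1C|exact: (fil_desc fM)]. Qed.

Let nZ i e : normal (Z i e).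
Proof.
by apply: layer_normal; [exact: nC|exact: nM|exact: nT|exact: TC].
Qed.
Let sZ i e := normal_sub (nZ i e).
Let Z_le i e e' : (e <= e')%N -> Z i e `<=` Z i e'.
Proof. by apply: layer_le => //; exact: MT. Qed.
Let Z_sub i e : Z i e `<=` T i.
Proof. by apply: layer_sub; exact: MT. Qed.

Let Z_full i : Z i E = T i.
Proof.
apply/seteqP; split; first exact: Z_sub.
have TN x u : T i x -> M 1 u -> M i.+1 [~ x, u].
  case: i => [|i] Tx Mu; first exact: normalRr.
  by apply: (fil_desc fM); rewrite -(addn1 i.+1); apply: (fil_comm fM).
apply: (@layer_full p C (M i.+1) (T i) _ _ _ _ _ (M 1) A) => //.
case: i {TN} => [|i]; first by left.
right=> x Mx; case: (posnP p) => [->|p0].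
  exact: (subgroup1 (normal_sub (nM _))).
by apply: (fil_le fM) (fil_pow fM _ Mx) => //; nia.
Qed.

Let Z_succ i e : (0 < e <= E)%N -> forall x y, C y -> Z i e x ->
  Z i e.-1 (x ^+ p) /\ Z i e.-1 [~ x, y].
Proof. by case: e => // e _ x y Cy [_ Zp /(_ y Cy)]. Qed.

Let gE : (b ^ E < g <= g * E)%N.
Proof. by rewrite /g /E ltnSn /= leq_pmulr. Qed.

Let q_big : [/\ (p * (g * E) < q)%N, ((g * E) * 3 < q)%N & (g * E * R < q)%N].
Proof. by rewrite /q; split; nia. Qed.

Let wt_le i e e' : (e <= e')%N -> (wt i e' <= wt i e)%N.
Proof.
move=> le_e; case: i => [|i] /=; last by rewrite leq_add2l leq_mul2l leq_sub2l ?orbT.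
by rewrite leq_pexp2l ?leq_sub2l //; rewrite /b; lia.
Qed.

Let wt_bound i e : (0 < e)%N -> (wt i e < q * i.+1)%N /\ (wt i e <= q * i + g * E)%N.
Proof.
move=> e0; have [_ q3 _] := q_big; have /andP[bg gE'] := gE.
case: i => [|i] /=.
  have : (b ^ (E - e) <= b ^ E)%N by rewrite leq_pexp2l ?leq_subr //; rewrite /b; lia.
  by lia.
have : (g * (E - e) <= g * E)%N by rewrite leq_mul2l leq_subr orbT.
by nia.
Qed.

Let wt_full i : (q * i <= wt i E)%N.
Proof. by case: i => [|i]; rewrite /= subnn; lia. Qed.

(* Both factors of a commutator may lie on the bottom level [C / M 1]; there
   the weights grow fast enough for doubling. *)
Let wt_bottom e : (0 < e <= E)%N -> (1 < e)%N ->
  (2 * wt 0 e < wt 0 e.-1)%N /\ (p * wt 0 e < wt 0 e.-1)%N.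
Proof.
move=> /andP[_ eE] e1; rewrite /wt.
have -> : (E - e.-1 = (E - e).+1)%N by lia.
have : (0 < b ^ (E - e))%N by rewrite expn_gt0 /b; lia.
by rewrite expnS /b; nia.
Qed.

Let M'_in i e x j : (0 < e <= E)%N -> (j <= wt i e)%N -> Z i e x -> M' j x.
Proof. by exists i, e. Qed.

Let M'_M i x j : (0 < i)%N -> (j <= q * i)%N -> M i x -> M' j x.
Proof.
move=> i0 le_j Mx; apply: (@M'_in i E); first by rewrite leqnn.
  exact: leq_trans (wt_full i).
by rewrite Z_full; case: i i0 Mx {le_j}.
Qed.

Let M'_commle i e i' e' x y : (0 < e <= E)%N -> (0 < e' <= E)%N ->
  (i' < i)%N || (i' == i) && (e <= e')%N ->
  Z i e x -> Z i' e' y -> M' (wt i e + wt i' e').+1 [~ x, y].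
Proof.
move=> He He' le_i Zx Zy; have [e0 eE] := andP He; have [e'0 e'E] := andP He'.
have [_ q3 _] := q_big; have /andP[bg gE'] := gE.
have [wi wi2] := wt_bound i e0; have [wi' wi'2] := wt_bound i' e'0.
have Cy : C y by apply: TC (Z_sub Zy).
have [_ Zxy] := Z_succ He Cy Zx.
case: i' => [|i'] in le_i Zy wi' wi'2 *; last first.
  case: i => [|i] in le_i Zx Zxy wi wi2 *; first by move: le_i; lia.
  apply: (@M'_M (i.+1 + i'.+1).+1) => //; first by nia.
  apply: (fil_comm fM) => //; [exact: (Z_sub Zx)|exact: (Z_sub Zy)].
case: (ltngtP e 1) => [||e1]; first by lia.
  move=> e1; apply: (@M'_in i e.-1) => //; first by lia.
  case: i => [|i] in le_i Zx Zxy wi wi2 *.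
    have [w2 _] := wt_bottom He e1.
    have := wt_le 0 (_ : (e <= e')%N); have : (e <= e')%N by lia.
    by move=> h /(_ h); lia.
  rewrite /=; have -> : (E - e.-1 = (E - e).+1)%N by lia.
  have : (b ^ (E - e') <= b ^ E)%N by rewrite leq_pexp2l ?leq_subr //; rewrite /b; lia.
  by nia.
rewrite e1 /= in Zxy; apply: (@M'_M i.+1) => //.
by move: wi wi2 wi' wi'2; rewrite e1; case: (i) => [|i0]; nia.
Qed.

Let M'_comm i e i' e' x y : (0 < e <= E)%N -> (0 < e' <= E)%N ->
  Z i e x -> Z i' e' y -> M' (wt i e + wt i' e').+1 [~ x, y].
Proof.
move=> He He' Zx Zy.
case le_i: ((i' < i)%N || (i' == i) && (e <= e')%N); first exact: M'_commle.
have [i1 [e1 [He1 w1 Z1]]] : M' (wt i' e' + wt i e).+1 [~ y, x].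
  by apply: M'_commle => //; lia.
by exists i1, e1; split=> //; [rewrite addnC|rewrite -invgR; exact: (subgroupV (sZ _ _))].
Qed.

Let Z_chain i e i' e' : Z i e `<=` Z i' e' \/ Z i' e' `<=` Z i e.
Proof.
wlog le_i : i e i' e' / (i < i')%N \/ i = i' /\ (e <= e')%N.
  move=> H; case: (ltngtP i i') => ii'; last case: (leqP e e') => ee'.
  - by apply: H; left.
  - by case: (H i' e' i e); auto.
  - by apply: H; right.
  - by case: (H i' e' i e); auto; right; split=> //; apply: ltnW.
case: le_i => [ii'|[<- ee']]; last by left; exact: Z_le.
right=> x /Z_sub Tx; apply: (Z_le (leq0n e)).
by case: i' => // i' in ii' Tx *; apply: (fil_le fM) Tx.
Qed.

Lemma layered_refinement :
  [/\ filtration p M' (q * R),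
      M' 1 = C, M' q = M 1 &
      [/\ forall l, heavy M R l -> heavy M' (q * R) l &
          forall l, (forall x, x \in l -> M 1 x) -> heavy M' (q * R) l -> heavy M R l]].
Proof.
have R0 := fil_gt0 fM; have q0 : (0 < q)%N by [].
have [qp q3 qR] := q_big; have /andP[bg gE'] := gE.
have fM' : filtration p M' (q * R).
  split=> [j|j x|i j x y _ _|i x _||]; last by rewrite muln_gt0.
  - apply/normal_subgroupP; split; last first.
      by move=> x h [i [e [He wj Zx]]]; exists i, e; split=> //; apply: (normalJ _ (nZ _ _)).
    apply/subgroupP; split.
    + apply: (@M'_M j.+1) => //; first by nia.
      exact: (subgroup1 (normal_sub (nM _))).
    + move=> x y [i [e [He wj Zx]]] [i' [e' [He' wj' Zy]]].
      case: (Z_chain i e i' e') => Zs; [exists i', e'|exists i, e]; split=> //.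
        by apply: (subgroupM (sZ _ _)) => //; exact: Zs.
      by apply: (subgroupM (sZ _ _)) => //; exact: Zs.
    + by move=> x [i [e [He wj Zx]]]; exists i, e; split=> //; apply: (subgroupV (sZ _ _)).
  - by move=> [i [e [He wj Zx]]]; exists i, e; split=> //; apply: ltnW.
  - move=> [i1 [e1 [He1 w1 Z1]]] [i2 [e2 [He2 w2 Z2]]].
    have [i3 [e3 [He3 w3 Z3]]] := M'_comm He1 He2 Z1 Z2.
    by exists i3, e3; split=> //; apply: leq_trans w3; rewrite ltnS leq_add.
  - move=> [i1 [e1 [He1 w1 Z1]]]; have [e0 eE] := andP He1.
    have [wi wi2] := wt_bound i1 e0.
    case: i1 => [|i1] in w1 Z1 wi wi2 *; last first.
      apply: (@M'_M (p * i1.+1).+1) => //; first by nia.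
      by apply: (fil_pow fM) => //; exact: (Z_sub Z1).
    have [Zp _] := Z_succ He1 (TC (Z_sub Z1)) Z1.
    case: (ltngtP e1 1) => [||e11]; first by lia.
      move=> e11; have [_ w2] := wt_bottom He1 e11.
      apply: (@M'_in 0 e1.-1) => //; first by lia.
      by apply: leq_trans w2; rewrite ltnS leq_mul2l w1 orbT.
    rewrite e11 /= in Zp; apply: (@M'_M 1) => //; nia.
  - move=> x [i [e [/andP[e0 eE] w1 Z1]]]; have [wi _] := wt_bound i e0.
    have Ri : (R <= i)%N by nia.
    apply: (fil_last fM); case: i Ri Z1 {w1 wi} => [|i] Ri Z1; first by lia.
    exact: (fil_le fM Ri (Z_sub Z1)).
split=> //.
- apply/seteqP; split=> [x [i [e [_ _ /Z_sub/TC]]] //|x Cx].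
  exists 0%N, E; split; rewrite ?leqnn //; last by rewrite Z_full.
  by rewrite /= subnn.
- apply/seteqP; split=> [x [i [e [/andP[e0 _] w1 Zx]]]|x Mx]; last first.
    by apply: (@M'_M 1) => //; rewrite muln1.
  have [wi _] := wt_bound i e0; case: i w1 Zx wi => [|i] w1 Zx wi; first by lia.
  exact: (fil_le fM _ (Z_sub Zx)).
split=> l.
  have : (q * R <= q * R)%N by []; move: {1 3}(q * R)%N => r'; move: (R) => r.
  elim: l r r' => [|x l IHl] r r' /=; first by move=> + r0; rewrite r0; lia.
  move=> le_r [j j0 [Mx /IHl hl]]; exists (q * j)%N; first by rewrite muln_gt0 j0.
  split; first by apply: (@M'_M j).
  by apply: hl; rewrite mulnBr; lia.
move=> Nl.
(* A word of [M]-weight below [R] has fewer than [R] letters, each of which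
   gains less than [g * E] beyond [q] times its weight. *)
have gain x j : M 1 x -> M' j x -> exists2 k, (0 < k)%N & M k x /\ (j <= q * k + g * E)%N.
  move=> Mx [i [e [/andP[e0 eE] w1 Zx]]]; have [wi wi2] := wt_bound i e0.
  case: i w1 Zx wi wi2 => [|i] w1 Zx wi wi2; first by exists 1%N => //; split=> //; lia.
  exists i.+1 => //; split; [exact: (Z_sub Zx)|lia].
suff hvy r s l' : (forall x, x \in l' -> M 1 x) -> (r <= R)%N ->
    (q * r <= s + g * E * (R - r))%N -> heavy M' s l' -> heavy M r l'.
  by apply: hvy => //; lia.
elim: l' r s {Nl} => [|x l' IHl] r s Nl rR le_r /=.
  move=> s0; rewrite {}s0 add0n in le_r; case: (posnP r) => // r0.
  have : (g * E * (R - r) <= g * E * R)%N by rewrite leq_mul2l leq_subr orbT.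
  have : (q * 1 <= q * r)%N by rewrite leq_mul2l r0 orbT.
  by rewrite muln1; lia.
move=> [j j0 [M'x hl]]; have [k k0 [Mx jk]] := gain _ _ (Nl x (mem_head _ _)) M'x.
exists k => //; split=> //; apply: IHl hl; last 1 first.
- case: (leqP r k) => rk; first by rewrite (_ : (r - k = 0)%N) ?muln0 //; lia.
  have -> : (R - (r - k) = (R - r) + k)%N by lia.
  have : (g * E <= g * E * k)%N by rewrite leq_pmulr.
  rewrite mulnBr mulnDr; move: jk le_r.
  move: (g * E * k)%N (g * E * (R - r))%N (q * r)%N (q * k)%N => u v w t.
  by move: (g * E)%N => z; lia.
- by move=> y yl; apply: Nl; rewrite inE yl orbT.
- by apply: leq_trans rR; apply: leq_subr.
Qed.

End Refinement.

(** The last two clauses make heaviness a property of the word alone,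
    independent of the stage at which it is measured. *)
Lemma filtration_refine p M R A :
  filtration p M R -> normal A -> nilpotent A ->
  (exists a, forall v, A v -> v ^+ (p ^ a) = 1) ->
  exists M' R' q, [/\ filtration p M' R',
    M' 1%N = [set x | exists u v, [/\ M 1%N u, A v & x = u * v]],
    (0 < q)%N /\ M' q = M 1%N,
    forall l, heavy M R l -> heavy M' R' l &
    forall l, (forall x, x \in l -> M 1%N x) -> heavy M' R' l -> heavy M R l].
Proof.
move=> fM nA [c Ac] [a Aa].
have [fM' M'1 M'q [h1 h2]] := layered_refinement fM nA Ac Aa.
by do 3!eexists; split; [exact: fM'| |split; [|exact: M'q]| |].
Qed.

End Filtrations.

(** * Differences of functions on a group *)
Section Differences.
Variables (G : groupType) (F : fieldType).
Implicit Types (f h : G -> F) (x y t : G) (l : seq G) (q : {poly F}).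
Local Open Scope ring_scope.

Local Notation "x ** y" := (x * y)%g (at level 40, left associativity).

Definition ldiff x f : G -> F := fun y => f (x ** y) - f y.
Definition rdiff t f : G -> F := fun y => f (y ** t) - f y.

Fixpoint ldiffs l f : G -> F := if l is x :: l' then ldiffs l' (ldiff x f) else f.

(** For [r = 0] the empty word is heavy, so that [f] vanishes on [K]. *)
Definition polynomial_on (M : nat -> set G) (K : set G) (r : nat) f : Prop :=
  forall l, (forall x, x \in l -> K x) -> heavy M r l ->
    forall y, K y -> ldiffs l f y = 0.

(** Right translation by [t] makes functions on [G] a module over [F[X]]. *)
Definition act t q f : G -> F := fun y => \sum_(i < size q) q`_i * f (y ** t ^+ i)%g.

Lemma act_widen t q f n y : (size q <= n)%N ->
  act t q f y = \sum_(i < n) q`_i * f (y ** t ^+ i)%g.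
Proof.
move=> qn; rewrite /act (big_ord_widen n (fun i => q`_i * f (y ** t ^+ i)%g) qn).
rewrite big_mkcond; apply: eq_bigr => i _; case: ltnP => // qi.
by rewrite nth_default // mul0r.
Qed.

Lemma actD t q q' f y : act t (q + q') f y = act t q f y + act t q' f y.
Proof.
rewrite (@act_widen _ (q + q') _ (maxn (size q) (size q'))) ?size_polyD //.
rewrite (@act_widen _ q _ (maxn (size q) (size q'))) ?leq_maxl //.
rewrite (@act_widen _ q' _ (maxn (size q) (size q'))) ?leq_maxr //.
by rewrite -big_split; apply: eq_bigr => i _; rewrite coefD mulrDl.
Qed.

Lemma actZ t c q f y : act t (c *: q) f y = c * act t q f y.
Proof.
rewrite (@act_widen _ (c *: q) _ (size q)) ?size_scale_leq // mulr_sumr.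
by apply: eq_bigr => i _; rewrite coefZ mulrA.
Qed.

Lemma actMX t q f y : act t (q * 'X) f y = act t q (fun z => f (z ** t)) y.
Proof.
rewrite (@act_widen _ (q * 'X) _ (size q).+1); last first.
  have [->|q0] := eqVneq q 0; first by rewrite mul0r size_poly0.
  by rewrite size_mulX.
rewrite big_ord_recl coefMX eqxx mul0r add0r; apply: eq_bigr => i _.
by rewrite coefMX /= expgSr mulgA.
Qed.

Lemma act1 t f y : act t 1 f y = f y.
Proof. by rewrite /act size_poly1 big_ord1 coef1 mul1r expg0 mulg1. Qed.

Lemma actX t f y : act t 'X f y = f (y ** t).
Proof. by rewrite -['X]mul1r actMX act1. Qed.

Lemma act_ext t q f h (K : set G) : (forall y, K y -> K (y ** t)) ->
  (forall y, K y -> f y = h y) -> forall y, K y -> act t q f y = act t q h y.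
Proof.
move=> Kt fh y Ky; apply: eq_bigr => i _; congr (_ * _); apply: fh.
elim: (nat_of_ord i) => [|n IHn]; first by rewrite expg0 mulg1.
by rewrite expgSr mulgA; apply: Kt.
Qed.

Lemma actM t q q' f y : act t (q * q') f y = act t q (act t q' f) y.
Proof.
elim/poly_ind: q f y => [|q c IHq] f y.
  by rewrite mul0r /act size_poly0 !big_ord0.
rewrite mulrDl (mulrAC q) !actD !actMX IHq mul_polyC actZ.
rewrite -[c%:P]mulr1 mul_polyC actZ act1; congr (_ + _).
apply: (@act_ext _ _ _ _ setT) => // z _.
apply: eq_bigr => i _; congr (_ * f _).
by rewrite -!mulgA -expgSr -expgS.
Qed.

Lemma act_rdiff t f y : act t ('X - 1) f y = rdiff t f y.
Proof. by rewrite -scaleN1r actD actX actZ act1 mulN1r. Qed.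

Lemma iter_rdiff t f n y : iter n (rdiff t) f y = act t (('X - 1) ^+ n) f y.
Proof.
elim: n f y => [|n IHn] f y; first by rewrite expr0 act1.
rewrite iterSr IHn exprSr actM; apply: (@act_ext _ _ _ _ setT) => // z _.
by rewrite act_rdiff.
Qed.

Lemma ldiff_rdiff x t f : ldiff x (rdiff t f) = rdiff t (ldiff x f).
Proof. by apply/funext => y; rewrite /ldiff /rdiff mulgA; ring. Qed.

Lemma iter_rdiff_ldiff x t f n :
  iter n (rdiff t) (ldiff x f) = ldiff x (iter n (rdiff t) f).
Proof. by elim: n => //= n ->; rewrite ldiff_rdiff. Qed.

Lemma iter_rdiffD t f h n :
  iter n (rdiff t) (fun y => f y + h y) =
  (fun y => iter n (rdiff t) f y + iter n (rdiff t) h y).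
Proof. by elim: n => //= n ->; apply/funext => y; rewrite /rdiff; ring. Qed.

Lemma iter_rdiffN t f n :
  iter n (rdiff t) (fun y => - f y) = (fun y => - iter n (rdiff t) f y).
Proof. by elim: n => //= n ->; apply/funext => y; rewrite /rdiff; ring. Qed.

Lemma iter_rdiff_ext t f h (K : set G) n : (forall y, K y -> K (y ** t)) ->
  (forall y, K y -> f y = h y) ->
  forall y, K y -> iter n (rdiff t) f y = iter n (rdiff t) h y.
Proof.
by move=> Kt fh; elim: n => //= n IHn y Ky; rewrite /rdiff !IHn //; exact: Kt.
Qed.

Section Polynomials.
Variables (p : nat) (M : nat -> set G) (R : nat) (K : set G).
Hypotheses (fM : filtration p M R) (sK : subgroup K) (KM1 : K `<=` M 1%N).
Local Notation P := (polynomial_on M K).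

Lemma polynomial_intro r f : (r = 0%N -> forall y, K y -> f y = 0) ->
  (forall x j, (0 < j)%N -> K x -> M j x -> P (r - j) (ldiff x f)) -> P r f.
Proof.
move=> f0 fd [|x l] Kl /= => [r0 y Ky|[j j0 [Mx hl]] y Ky]; first exact: f0.
apply: (fd x j) => // [|z zl]; first by apply: Kl; rewrite mem_head.
by apply: Kl; rewrite inE zl orbT.
Qed.

Lemma polynomial_ldiff r f x j : (0 < j)%N -> K x -> M j x -> P r f ->
  P (r - j) (ldiff x f).
Proof.
move=> j0 Kx Mx Pf l Kl hl y Ky; apply: (Pf (x :: l)) => //=; last by exists j.
by move=> z; rewrite inE => /predU1P[->|/Kl].
Qed.

Lemma polynomial0 f : P 0 f -> forall y, K y -> f y = 0.
Proof. by move=> Pf y Ky; apply: (Pf [::]). Qed.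

Lemma heavy_le r r' l : (r <= r')%N -> heavy M r' l -> heavy M r l.
Proof.
elim: l r r' => [|x l IHl] r r' rr' /=; first by lia.
by move=> [j j0 [Mx hl]]; exists j => //; split=> //; apply: IHl hl; lia.
Qed.

Lemma polynomial_le r r' f : (r <= r')%N -> P r f -> P r' f.
Proof. by move=> rr' Pf l Kl /(heavy_le rr'); exact: Pf. Qed.

Lemma ldiffs_ext l f h : (forall x, x \in l -> K x) ->
  (forall y, K y -> f y = h y) -> forall y, K y -> ldiffs l f y = ldiffs l h y.
Proof.
elim: l f h => [//|x l IHl] f h Kl fh y Ky /=; apply: IHl => // [z zl|z Kz].
  by apply: Kl; rewrite inE zl orbT.
rewrite /ldiff !fh //; apply: (subgroupM sK) => //; apply: Kl; exact: mem_head.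
Qed.

Lemma polynomial_ext r f h : (forall y, K y -> f y = h y) -> P r f -> P r h.
Proof. by move=> fh Pf l Kl hl y Ky; rewrite -(ldiffs_ext Kl fh) //; apply: Pf. Qed.

Lemma ldiffsD l f h y :
  ldiffs l (fun z => f z + h z) y = ldiffs l f y + ldiffs l h y.
Proof.
elim: l f h => //= x l IHl f h; rewrite -IHl; congr (ldiffs l _ y).
by apply/funext => z; rewrite /ldiff; ring.
Qed.

Lemma ldiffsZ c l f y : ldiffs l (fun z => c * f z) y = c * ldiffs l f y.
Proof.
elim: l f => //= x l IHl f; rewrite -IHl; congr (ldiffs l _ y).
by apply/funext => z; rewrite /ldiff; ring.
Qed.

Lemma polynomialD r f h : P r f -> P r h -> P r (fun y => f y + h y).
Proof. by move=> Pf Ph l Kl hl y Ky; rewrite ldiffsD Pf // Ph // addr0. Qed.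

Lemma polynomialZ r c f : P r f -> P r (fun y => c * f y).
Proof. by move=> Pf l Kl hl y Ky; rewrite ldiffsZ Pf // mulr0. Qed.

Lemma polynomial_zero r f : (forall y, K y -> f y = 0) -> P r f.
Proof.
move=> f0 l Kl _ y Ky; rewrite (@ldiffs_ext l f (fun z => 0 * f z)) //.
  by rewrite ldiffsZ mul0r.
by move=> z /f0 ->; rewrite mulr0.
Qed.

Lemma polynomial_sum r n (f : 'I_n -> G -> F) : (forall i, P r (f i)) ->
  P r (fun y => \sum_(i < n) f i y).
Proof.
elim: n f => [|n IHn] f Pf.
  by apply: polynomial_zero => y _; rewrite big_ord0.
apply: (@polynomial_ext _ (fun y => f ord0 y + \sum_(i < n) f (lift ord0 i) y)).
  by move=> y _; rewrite big_ord_recl.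
by apply: polynomialD => //; apply: IHn.
Qed.

Lemma polynomial_const c : P 1 (fun=> c).
Proof.
apply: polynomial_intro => // x j _ _ _; apply: polynomial_zero => y _.
by rewrite /ldiff subrr.
Qed.

Lemma polynomial_ltrans r f x : K x -> P r f -> P r (fun y => f (x ** y)).
Proof.
move=> Kx Pf; apply: (@polynomial_ext _ (fun y => f y + ldiff x f y)).
  by move=> y _; rewrite /ldiff; ring.
apply: polynomialD => //; apply: (@polynomial_le (r - 1)); first exact: leq_subr.
by apply: polynomial_ldiff => //; exact: KM1.
Qed.

Lemma polynomial_conj r f z : (forall k, K k -> K (k ^ z)%g) -> P r f ->
  P r (fun y => f (y ^ z)%g).
Proof.
move=> Kz; elim/ltn_ind: r f => r IHr f Pf; case: (posnP r) => [r0|r0].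
  rewrite r0 in Pf *; apply: polynomial_zero => y Ky.
  by apply: polynomial0 => //; exact: Kz.
apply: polynomial_intro => [|x j j0 Kx Mx]; first by lia.
apply: (@polynomial_ext _ (fun y => ldiff (x ^ z)%g f (y ^ z)%g)).
  by move=> y _; rewrite /ldiff conjMg.
apply: IHr; first by lia.
apply: polynomial_ldiff => //; first exact: Kz.
by apply: (normalJ _ (fil_normal fM j)).
Qed.

(** Conjugation by an element of level [a] moves an element of level [j] by a
    factor of level above [a + j], so it disturbs a function only to order [a]. *)
Lemma polynomial_conj_diff r f z a : (0 < a)%N -> M a z ->
  (forall k, K k -> K (k ^ z)%g) -> P r f ->
  P (r - a) (fun y => f (y ^ z)%g - f y).
Proof.
move=> a0 Mz Kz.
have wE k : (k ^ z)%g = ([~ k, z] ^ k^-1)%g ** k.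
  by rewrite /commg /conjg ?gnorm.
have Kw k : K k -> K ([~ k, z] ^ k^-1)%g.
  by move=> Kk; apply: (subgroupMr sK Kk); rewrite -wE; exact: Kz.
have Mw j k : (0 < j)%N -> M j k -> M (j + a).+1 ([~ k, z] ^ k^-1)%g.
  move=> j0 Mk; apply: (normalJ _ (fil_normal fM _)).
  exact: (fil_comm fM j0 a0).
elim/ltn_ind: r f => r IHr f Pf; case: (posnP r) => [r0|r0].
  rewrite r0 in Pf *; apply: polynomial_zero => y Ky.
  by rewrite !(polynomial0 Pf) ?subrr //; exact: Kz.
apply: polynomial_intro => [ra y Ky|x j j0 Kx Mx].
  have := polynomial_ldiff (r := r) _ (Kw _ Ky) (Mw _ _ (ltn0Sn 0) (KM1 Ky)) Pf.
  have -> : (r - (1 + a).+1 = 0)%N by lia.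
  by move=> /(_ isT)/polynomial0/(_ _ Ky); rewrite /ldiff -wE.
apply: (@polynomial_ext _ (fun y =>
   (ldiff (x ^ z)%g f (y ^ z)%g - ldiff (x ^ z)%g f y)
    + ldiff ([~ x, z] ^ x^-1)%g f (x ** y))).
  by move=> y _; rewrite /ldiff conjMg (mulgA ([~ x, z] ^ x^-1)%g) -wE; ring.
apply: polynomialD.
  rewrite subnAC; apply: IHr; first by lia.
  apply: polynomial_ldiff => //; first exact: Kz.
  by apply: (normalJ _ (fil_normal fM j)).
apply: (@polynomial_le (r - (j + a).+1)); first by lia.
apply: (polynomial_ltrans Kx); apply: polynomial_ldiff => //; first exact: Kw.
exact: Mw.
Qed.

(** Right translation by [k] is left translation by [k] after conjugation by
    [k], so right differences lower the order as much as left ones. *)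
Lemma polynomial_rdiff r f k a : (0 < a)%N -> K k -> M a k -> P r f ->
  P (r - a) (rdiff k f).
Proof.
move=> a0 Kk Mk Pf.
have Kc y : K y -> K (y ^ k)%g.
  move=> Ky; rewrite /conjg; apply: (subgroupM sK); first exact: (subgroupV sK).
  exact: (subgroupM sK).
apply: (@polynomial_ext _ (fun y => ldiff k f (y ^ k)%g + (f (y ^ k)%g - f y))).
  by move=> y _; rewrite /ldiff /rdiff -conjgC; ring.
apply: polynomialD; last exact: polynomial_conj_diff.
by apply: (polynomial_conj Kc); exact: polynomial_ldiff.
Qed.

Lemma polynomial_rtrans r f k : K k -> P r f -> P r (fun y => f (y ** k)).
Proof.
move=> Kk Pf; apply: (@polynomial_ext _ (fun y => f y + rdiff k f y)).
  by move=> y _; rewrite /rdiff; ring.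
apply: polynomialD => //; apply: (@polynomial_le (r - 1)); first exact: leq_subr.
by apply: polynomial_rdiff => //; exact: KM1.
Qed.

Lemma polynomial_act r f k q : K k -> P r f -> P r (act k q f).
Proof.
move=> Kk Pf; apply: polynomial_sum => i; apply: polynomialZ.
by apply: polynomial_rtrans => //; exact: subgroupX.
Qed.

Lemma polynomial_iter_rdiff r f k a n : (0 < a)%N -> K k -> M a k -> P r f ->
  P (r - n * a) (iter n (rdiff k) f).
Proof.
move=> a0 Kk Mk Pf; elim: n => [|n IHn]; first by rewrite mul0n subn0.
by rewrite /= mulSn addnC subnDA; apply: polynomial_rdiff.
Qed.

Lemma polynomial_act_Xn r f k a n q : (0 < a)%N -> K k -> M a k -> P r f ->
  P (r - n * a) (act k (('X - 1) ^+ n * q) f).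
Proof.
move=> a0 Kk Mk Pf.
apply: (@polynomial_ext _ (iter n (rdiff k) (act k q f))).
  by move=> y _; rewrite iter_rdiff actM.
by apply: polynomial_iter_rdiff => //; apply: polynomial_act.
Qed.

End Polynomials.
End Differences.

(** * Functions on a cyclic extension *)
Section CyclicExtension.
Variables (G : groupType) (F : fieldType).
Variables (p : nat) (M : nat -> set G) (R : nat) (K : set G) (s : nat) (t : G).
Hypotheses (fM : filtration p M R) (sK : subgroup K).
Hypotheses (MK : M s.+1 `<=` K) (KM : K `<=` M s).
Hypotheses (s0 : (0 < s)%N) (Mt : M s t).
Implicit Types (f h : G -> F) (x y z k : G) (q : {poly F}).
Local Open Scope ring_scope.

Local Notation "x ** y" := (x * y)%g (at level 40, left associativity).
Local Notation P := (polynomial_on M K).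

Definition adjoin : set G :=
  [set x | exists k a b, K k /\ x = k ** t ^+ a ** t ^- b]%g.

Let sM : subgroup (M s). Proof. exact: (normal_sub (fil_normal fM s)). Qed.
Let KM1 : K `<=` M 1%N. Proof. by move=> x /KM; apply: (fil_le fM). Qed.

Let K_conj k z : M s z -> K k -> K (k ^ z)%g.
Proof.
move=> Mz Kk; rewrite -(mulVKg k (k ^ z)%g) -commgEl.
apply: (subgroupM sK Kk); apply: MK.
by apply: (fil_le fM _ (fil_comm fM s0 s0 (KM Kk) Mz)); rewrite ltnS leq_addl.
Qed.

Lemma sub_adjoin : K `<=` adjoin.
Proof. by move=> k Kk; exists k, 0%N, 0%N; rewrite !expg0 invg1 !mulg1. Qed.

Lemma mem_adjoin : adjoin t.
Proof.
exists 1%g, 1%N, 0%N; rewrite expg0 expg1 invg1 mulg1 mul1g; split=> //.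
exact: (subgroup1 sK).
Qed.

Lemma adjoin_subgroup : subgroup adjoin.
Proof.
have tt a b : (t ^+ a ** t ^- b = t ^- b ** t ^+ a)%g.
  by apply: commute_sym; apply: commute_sym; apply: commuteV; apply: commuteX2.
have Mtt a b : M s (t ^+ a ** t ^- b)%g.
  by apply: (subgroupM sM); [|apply: (subgroupV sM)]; apply: (subgroupX _ sM).
apply/subgroupP; split; first exact: sub_adjoin (subgroup1 sK).
- move=> _ _ [k [a [b [Kk ->]]]] [k' [a' [b' [Kk' ->]]]].
  exists (k ** k' ^ (t ^+ a ** t ^- b)^-1)%g, (a + a')%N, (b + b')%N; split.
    by apply: (subgroupM sK) => //; apply: K_conj => //; apply: (subgroupV sM).
  have cb : commute (t ^- b)%g (t ^+ a' ** t ^- b')%g.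
    apply: commuteM; first exact/esym/tt.
    by apply: commuteV; apply: commute_sym; apply: commuteV; apply: commuteX2.
  rewrite -!mulgA.
  have -> : (t ^+ (a + a') ** t ^- (b + b') = t ^+ a ** t ^- b ** (t ^+ a' ** t ^- b'))%g.
    by rewrite !expgnDr invgM -!mulgA cb -mulgA.
  by rewrite /conjg ?gnorm.
- move=> _ [k [a [b [Kk ->]]]].
  exists (k^-1 ^ (t ^+ a ** t ^- b))%g, b, a; split.
    by apply: K_conj => //; apply: (subgroupV sK).
  by rewrite /conjg ?gnorm.
Qed.
Let sH := adjoin_subgroup.

Lemma adjoin_sub : adjoin `<=` M s.
Proof.
move=> _ [k [a [b [Kk ->]]]]; apply: (subgroupM sM); first apply: (subgroupM sM).
- exact: KM.
- exact: (subgroupX _ sM).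
- by apply: (subgroupV sM); apply: (subgroupX _ sM).
Qed.

Let H_rmul y : adjoin y -> adjoin (y ** t).
Proof. by move=> Hy; apply: (subgroupM sH Hy); exact: mem_adjoin. Qed.

Lemma rdiff_zero_ext f : (forall k, K k -> f k = 0) ->
  (forall x, adjoin x -> rdiff t f x = 0) -> forall x, adjoin x -> f x = 0.
Proof.
move=> f0 df; have ft x n : adjoin x -> f (x ** t ^+ n)%g = f x.
  move=> Hx; elim: n => [|n IHn]; first by rewrite expg0 mulg1.
  rewrite expgSr mulgA -IHn; apply/eqP; rewrite -subr_eq0; apply/eqP.
  by apply: df; apply: (subgroupM sH) => //; apply: (subgroupX _ sH); exact: mem_adjoin.
move=> _ [k [a [b [Kk ->]]]]; rewrite -(ft _ b) ?mulgVK; last first.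
  by exists k, a, b.
by rewrite ft ?f0 //; exact: sub_adjoin.
Qed.

(** The differences in the direction of [t] are only tested on [K]. They
    determine the values on [K * t ^+ i]; that some difference vanishes on all
    of [adjoin] makes them determine the values at negative powers too. *)
Definition adjoin_poly (r : nat) f : Prop :=
  (exists m, forall x, adjoin x -> iter m (rdiff t) f x = 0) /\
  forall j, P (r - j * s) (iter j (rdiff t) f).

Local Notation Q := adjoin_poly.

Lemma adjoin_poly0 f : Q 0 f -> forall x, adjoin x -> f x = 0.
Proof.
move=> [[m]]; elim: m f => [|m IHm] f fm Pf //.
apply: rdiff_zero_ext => [k Kk|]; first exact: (polynomial0 (Pf 0%N)).
apply: IHm => [x Hx|j]; first by rewrite -iterSr; exact: fm.
by rewrite -iterSr; exact: Pf j.+1.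
Qed.

Lemma adjoin_poly_zero r f : (forall x, adjoin x -> f x = 0) -> Q r f.
Proof.
move=> f0; split; first by exists 0%N.
move=> j; apply: (polynomial_zero sK) => k /sub_adjoin.
elim: j (k) => [//|j IHj] x Hx /=.
by rewrite /rdiff !IHj ?subrr //; exact: H_rmul.
Qed.

Lemma adjoin_poly_le r r' f : (r <= r')%N -> Q r f -> Q r' f.
Proof.
move=> rr' [fm Pf]; split=> // j; apply: polynomial_le (Pf j).
by rewrite leq_sub2r.
Qed.

Lemma adjoin_poly_ext r f h : (forall x, adjoin x -> f x = h x) -> Q r f -> Q r h.
Proof.
move=> fh [[m fm] Pf]; split.
  exists m => x Hx; rewrite -(iter_rdiff_ext _ H_rmul fh) //; exact: fm.
move=> j; apply: (polynomial_ext sK) (Pf j) => k Kk.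
by apply: (iter_rdiff_ext _ H_rmul fh); exact: sub_adjoin.
Qed.

Lemma adjoin_polyD r f h : Q r f -> Q r h -> Q r (fun y => f y + h y).
Proof.
move=> [[m fm] Pf] [[n hn] Ph]; split; last first.
  by move=> j; rewrite iter_rdiffD; apply: polynomialD.
have vanish u a b x : (forall y, adjoin y -> iter a (rdiff t) u y = 0) ->
    adjoin x -> iter (b + a) (rdiff t) u x = 0.
  move=> ua; elim: b x => [|b IHb] x Hx; first exact: ua.
  by rewrite addSn /= /rdiff !IHb ?subrr //; exact: H_rmul.
exists (n + m)%N => x Hx; rewrite iter_rdiffD vanish // addnC vanish //.
by rewrite addr0.
Qed.

Lemma adjoin_polyN r f : Q r f -> Q r (fun y => - f y).
Proof.
move=> [[m fm] Pf]; split.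
  by exists m => x Hx; rewrite iter_rdiffN fm ?oppr0.
move=> j; rewrite iter_rdiffN.
apply: (@polynomial_ext _ _ _ _ sK _ (fun y => -1 * iter j (rdiff t) f y)).
  by move=> y _; rewrite mulN1r.
exact: polynomialZ.
Qed.

Let vanish_ldiff x f m : adjoin x ->
  (forall y, adjoin y -> iter m (rdiff t) f y = 0) ->
  forall y, adjoin y -> iter m (rdiff t) (ldiff x f) y = 0.
Proof.
move=> Hx fm y Hy; rewrite iter_rdiff_ldiff /ldiff !fm ?subrr //.
exact: (subgroupM sH).
Qed.

Lemma adjoin_poly_ldiffK r f k j : (0 < j)%N -> K k -> M j k -> Q r f ->
  Q (r - j) (ldiff k f).
Proof.
move=> j0 Kk Mk [[m fm] Pf]; split.
  by exists m; apply: vanish_ldiff => //; exact: sub_adjoin.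
by move=> i; rewrite iter_rdiff_ldiff subnAC; apply: polynomial_ldiff.
Qed.

Lemma adjoin_poly_ldifft r f : Q r f -> Q (r - s) (ldiff t f).
Proof.
move=> [[m fm] Pf]; split; first by exists m; apply: vanish_ldiff => //; exact: mem_adjoin.
move=> i; rewrite iter_rdiff_ldiff subnAC.
have MtV : M s t^-1%g by apply: (subgroupV sM).
have Kt k : K k -> K (k ^ t^-1)%g by apply: K_conj.
set h := iter i (rdiff t) f.
apply: (@polynomial_ext _ _ _ _ sK _ (fun y => rdiff t h (y ^ t^-1)%g +
    (h (y ^ t^-1)%g - h y))).
  by move=> y _; rewrite /ldiff /rdiff -conjgCV; ring.
apply: polynomialD; last exact: (polynomial_conj_diff fM sK KM1 s0).
apply: (polynomial_conj fM sK Kt).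
by have := Pf i.+1; rewrite mulSn addnC subnDA.
Qed.

Definition lowers x := forall r f, Q r f -> Q (r - s) (ldiff x f).

(** Inverses are the delicate case: translation by [y^-1] preserves the order
    by induction on the order, since it differs from the identity by its own
    composite with the difference in the direction of [y]. *)
Lemma lowers_adjoin x : adjoin x -> lowers x.
Proof.
have lowerM y z : lowers y -> lowers z -> lowers (y ** z).
  move=> ly lz r f Qf.
  apply: (@adjoin_poly_ext _ (fun x => (ldiff y f x + ldiff z (ldiff y f) x)
                                        + ldiff z f x)).
    by move=> w _; rewrite /ldiff !mulgA; ring.
  apply: adjoin_polyD; last exact: lz.
  apply: adjoin_polyD; first exact: ly.
  apply: (@adjoin_poly_le (r - s - s)); first exact: leq_subr.
  by apply: lz; apply: ly.
have lowerV y : adjoin y -> lowers y -> lowers y^-1%g.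
  move=> Hy ly; have QV r f : Q r f -> Q r (fun z => f (y^-1 ** z)%g).
    elim/ltn_ind: r f => r IHr f Qf; case: (posnP r) => [r0|r0].
      rewrite r0 in Qf *; apply: adjoin_poly_zero => z Hz.
      apply: (adjoin_poly0 Qf); apply: (subgroupM sH) => //.
      exact: (subgroupV sH).
    apply: (@adjoin_poly_ext _ (fun z => f z + - ldiff y f (y^-1 ** z)%g)).
      by move=> z _; rewrite /ldiff mulVKg; ring.
    apply: adjoin_polyD => //; apply: adjoin_polyN.
    apply: (@adjoin_poly_le (r - s)); first exact: leq_subr.
    by apply: IHr; [lia|exact: ly].
  move=> r f Qf; apply: (@adjoin_poly_ext _ (fun z => - ldiff y f (y^-1 ** z)%g)).
    by move=> z _; rewrite /ldiff mulVKg; ring.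
  by apply: adjoin_polyN; apply: QV; exact: ly.
have lowerX y n : lowers y -> lowers (y ^+ n)%g.
  move=> ly; elim: n => [|n IHn]; last by rewrite expgS; apply: lowerM.
  rewrite expg0 => r f _; apply: adjoin_poly_zero => z _.
  by rewrite /ldiff mul1g subrr.
case=> [k [a [b [Kk ->]]]]; apply: (lowerM); first apply: (lowerM).
- by move=> r f; apply: adjoin_poly_ldiffK => //; exact: KM.
- exact/lowerX/adjoin_poly_ldifft.
- apply: lowerV; first by apply: (subgroupX _ sH); exact: mem_adjoin.
  exact/lowerX/adjoin_poly_ldifft.
Qed.

(** Elements outside [K] have level at most [s], because [K] contains the level
    [s.+1]; so lowering the order by [s] is all that they require. *)
Lemma adjoin_polyP r f : Q r f -> polynomial_on M adjoin r f.
Proof.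
move=> Qf l; elim: l r f Qf => [|x l IHl] r f Qf Hl /= hl.
  by rewrite hl in Qf; exact: adjoin_poly0.
have [j j0 [Mx {}hl]] := hl.
have Hx : adjoin x by apply: Hl; rewrite mem_head.
apply: (IHl _ (ldiff x f) _ _ hl); last by move=> z zl; apply: Hl; rewrite inE zl orbT.
have [Kx|nKx] := pselect (K x); first exact: adjoin_poly_ldiffK.
apply: (@adjoin_poly_le (r - s)); last exact: lowers_adjoin.
apply: leq_sub2l; rewrite leqNgt; apply/negP => sj; apply: nKx; apply: MK.
exact: (fil_le fM sj).
Qed.

(** * Extending functions across a cyclic step *)

(** Elements of [adjoin] have several expressions; the two exponents allow
    negative powers of [t]. *)
Lemma adjoin_fun (v : G -> nat -> nat -> F) :
  (forall k a b k' a' b', K k -> K k' ->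
     (k ** t ^+ a ** t ^- b = k' ** t ^+ a' ** t ^- b')%g -> v k a b = v k' a' b') ->
  exists f, forall k a b, K k -> f (k ** t ^+ a ** t ^- b)%g = v k a b.
Proof.
move=> vP; pose S x := [set y : F | exists k a b,
  [/\ K k, x = (k ** t ^+ a ** t ^- b)%g & y = v k a b]].
exists (fun x => xget 0 (S x)) => k a b Kk.
case: xgetP => [y _ [k' [a' [b' [Kk' e ->]]]]|/(_ (v k a b))[]]; last by exists k, a, b.
by apply: vP.
Qed.

Let infinite_uniq k a b k' a' b' : (forall n, (0 < n)%N -> ~ K (t ^+ n)%g) ->
  K k -> K k' -> (k ** t ^+ a ** t ^- b = k' ** t ^+ a' ** t ^- b')%g ->
  k = k' /\ (a + b' = a' + b)%N.
Proof.
move=> Kt Kk Kk' e.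
wlog le_ab : k a b k' a' b' Kk Kk' e / (a + b' <= a' + b)%N.
  move=> H; case: (leqP (a + b') (a' + b)) => ab; first exact: H.
  by have [-> ->] := H _ _ _ _ _ _ Kk' Kk (esym e) (ltnW ab).
have {}e : (k ** t ^+ (a + b') = k' ** t ^+ (a' + b))%g.
  have := congr1 (fun z => z ** (t ^+ b ** t ^+ b'))%g e.
  rewrite !mulgA mulgVK -(mulgA _ (t ^+ b)%g) -expgnDr addnC expgnDr mulgA mulgVK.
  by rewrite -!mulgA -!expgnDr.
have {}e : (k'^-1 ** k = t ^+ (a' + b - (a + b')))%g.
  apply: (mulIg (t ^+ (a + b'))%g); rewrite -mulgA e mulKg -expgnDr subnK //.
case: (posnP (a' + b - (a + b'))) => [ab|ab].
  split; last by lia.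
  by move: e; rewrite ab expg0 => /(canRL (mulKg _)); rewrite invgK mulg1.
case: (Kt _ ab); rewrite -e; apply: (subgroupM sK) => //; exact: (subgroupV sK).
Qed.

(** The extension is invariant under right translation by [t]. *)
Lemma extend_infinite r f : (forall n, (0 < n)%N -> ~ K (t ^+ n)%g) -> P r f ->
  exists2 h, forall k, K k -> h k = f k & Q r h.
Proof.
move=> Kt Pf; have [k a b k' a' b' Kk Kk'|h hE] := @adjoin_fun (fun k _ _ => f k).
  by move=> /(infinite_uniq Kt Kk Kk')[-> _].
have hK k : K k -> h k = f k.
  by move=> Kk; rewrite -(hE k 0%N 0%N) // !expg0 invg1 !mulg1.
have dh x : adjoin x -> rdiff t h x = 0.
  move=> [k [a [b [Kk ->]]]]; rewrite /rdiff hE //.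
  rewrite (_ : k ** t ^+ a ** t ^- b ** t = k ** t ^+ a.+1 ** t ^- b)%g.
    by rewrite hE // subrr.
  rewrite expgSr -!mulgA; congr (_ ** (_ ** _))%g.
  by apply: commute_sym; apply: commuteV; apply: commuteX.
exists h => //; split; first by exists 1%N.
case=> [|j]; first by rewrite mul0n subn0; apply: (polynomial_ext sK) Pf => k /hK.
apply: (polynomial_zero sK) => k /sub_adjoin; rewrite iterSr.
by elim: j k => [|j IHj] k Hk /=; [exact: dh|rewrite /rdiff !IHj ?subrr //; exact: H_rmul].
Qed.

Lemma affine_adjoin_poly r h : (s < r)%N -> (forall k, K k -> h k = 0) ->
  (forall x, adjoin x -> rdiff t h x = 1) -> Q r h.
Proof.
move=> sr hK dh; split.
  by exists 2%N => x Hx /=; rewrite {1}/rdiff !dh ?subrr //; exact: H_rmul.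
case=> [|[|j]].
- by apply: (polynomial_zero sK) => k /hK.
- apply: (@polynomial_le _ _ _ _ 1); first by lia.
  apply: (@polynomial_ext _ _ _ _ sK _ (fun=> 1)); last exact: polynomial_const.
  by move=> k /sub_adjoin/dh.
apply: (polynomial_zero sK) => k /sub_adjoin; rewrite !iterSr.
elim: j k => [|j IHj] k Hk /=; last by rewrite /rdiff !IHj ?subrr //; exact: H_rmul.
by rewrite {1}/rdiff !dh ?subrr //; exact: H_rmul.
Qed.

Lemma coordinate_infinite r : (forall n, (0 < n)%N -> ~ K (t ^+ n)%g) ->
  (s < r)%N -> exists h, [/\ forall k, K k -> h k = 0, h t = 1 & Q r h].
Proof.
move=> Kt sr.
have [k a b k' a' b' Kk Kk'|h hE] := @adjoin_fun (fun _ a b => a%:R - b%:R).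
  move=> /(infinite_uniq Kt Kk Kk')[_ ab].
  by apply/eqP; rewrite subr_eq addrAC eq_sym subr_eq -!natrD ab.
have hK k : K k -> h k = 0.
  by move=> Kk; have := hE k 0%N 0%N Kk; rewrite !expg0 invg1 !mulg1 subrr.
have dh x : adjoin x -> rdiff t h x = 1.
  move=> [k [a [b [Kk ->]]]]; rewrite /rdiff hE //.
  rewrite (_ : k ** t ^+ a ** t ^- b ** t = k ** t ^+ a.+1 ** t ^- b)%g.
    by rewrite hE // -natr1; ring.
  rewrite expgSr -!mulgA; congr (_ ** (_ ** _))%g.
  by apply: commute_sym; apply: commuteV; apply: commuteX.
exists h; split=> //.
  have := hE 1%g 1%N 0%N (subgroup1 sK).
  by rewrite expg0 expg1 invg1 mulg1 mul1g subr0.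
exact: affine_adjoin_poly.
Qed.

Section FiniteOrder.
Variable n : nat.
Hypotheses (n0 : (0 < n)%N) (Ktn : K (t ^+ n)%g).
Hypothesis n_min : forall i, K (t ^+ i)%g -> (n %| i)%N.

Lemma adjoin_finite x : adjoin x -> exists k i, K k /\ x = (k ** t ^+ i)%g.
Proof.
move=> [k [a [b [Kk ->]]]].
exists (k ** t ^- (n * b))%g, (a + (n * b - b))%N; split.
  apply: (subgroupM sK) => //; apply: (subgroupV sK).
  by rewrite expgnA; apply: (subgroupX _ sK).
rewrite expgnDr expgnFr ?leq_pmull // -!mulgA; congr (_ ** _)%g.
have -> : (t ^- (n * b) ** (t ^+ a ** (t ^+ (n * b) ** t ^- b)) =
           t ^- (n * b) ** (t ^+ a ** t ^+ (n * b)) ** t ^- b)%g by rewrite !mulgA.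
by rewrite -expgnDr addnC expgnDr mulKg.
Qed.

Lemma finite_shift k i k' i' : (i <= i')%N -> K k -> K k' ->
  (k ** t ^+ i = k' ** t ^+ i')%g ->
  exists m, (i' = i + n * m)%N /\ k = (k' ** t ^+ (n * m))%g.
Proof.
move=> ii' Kk Kk' e; have {}e : k = (k' ** t ^+ (i' - i))%g.
  by apply: (mulIg (t ^+ i)%g); rewrite e -mulgA -expgnDr subnK.
have /n_min/dvdnP[m mE] : K (t ^+ (i' - i))%g.
  rewrite -(mulKg k' (t ^+ (i' - i))%g) -e; apply: (subgroupM sK) => //.
  exact: (subgroupV sK).
by exists m; rewrite mulnC -mE subnKC.
Qed.

Lemma adjoin_fun_finite (v : G -> nat -> F) :
  (forall k i m, K k -> v k (i + n * m)%N = v (k ** t ^+ (n * m))%g i) ->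
  exists h, forall k i, K k -> h (k ** t ^+ i)%g = v k i.
Proof.
move=> vP; pose S x := [set y : F | exists k i, [/\ K k, x = (k ** t ^+ i)%g & y = v k i]].
exists (fun x => xget 0 (S x)) => k i Kk.
case: xgetP => [y _ [k' [i' [Kk' e ->]]]|/(_ (v k i))[]]; last by exists k, i.
case: (leqP i i') => ii'.
  by have [m [-> ->]] := finite_shift ii' Kk Kk' e; rewrite vP.
by have [m [-> ->]] := finite_shift (ltnW ii') Kk' Kk (esym e); rewrite vP.
Qed.

(** On functions of order [r] along [K], translation by [c := t ^+ n] is an
    operator [X] with [(X - 1) ^+ r = 0], and [sigma] is an [n]-th root of it.
    Letting [t] act as [sigma] extends [f]; as [sigma - 1] is a multiple of
    [X - 1], differences in the direction of [t] lower the order as those in the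
    direction of [c] do. *)
Lemma extend_root r f (sigma tau u : {poly F}) :
  sigma ^+ n = 'X + ('X - 1) ^+ r * u -> sigma - 1 = ('X - 1) * tau ->
  P r f -> exists2 h, forall k, K k -> h k = f k & Q r h.
Proof.
set c := (t ^+ n)%g => sigman sigma1 Pf.
have Kc y : K y -> K (y ** c) by move=> Ky; apply: (subgroupM sK).
have act_sigman g y : P r g -> K y -> act c (sigma ^+ n) g y = g (y ** c).
  move=> Pg Ky; rewrite sigman actD actX -[RHS]addr0; congr (_ + _).
  apply: polynomial0 Ky; rewrite (_ : 0%N = (r - r * s)%N); last by nia.
  by apply: (polynomial_act_Xn fM sK KM1) => //; exact: KM.
have act_P q g : P r g -> P r (act c q g) by apply: (polynomial_act fM sK KM1).
have [|h hE] := @adjoin_fun_finite (fun k i => act c (sigma ^+ i) f k).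
  move=> k i m Kk; elim: m k Kk => [|m IHm] k Kk.
    by rewrite muln0 addn0 expg0 mulg1.
  rewrite mulnS addnCA addnA -addnA exprD actM act_sigman //; last exact: act_P.
  by rewrite IHm ?expgnDr ?mulgA //; exact: Kc.
have dh j k i : K k ->
    iter j (rdiff t) h (k ** t ^+ i)%g = act c ((sigma - 1) ^+ j * sigma ^+ i) f k.
  move=> Kk; elim: j i => [|j IHj] i; first by rewrite expr0 mul1r /= hE.
  rewrite /= /rdiff -mulgA -expgSr !IHj.
  have -> : (sigma - 1) ^+ j.+1 * sigma ^+ i =
      (sigma - 1) ^+ j * sigma ^+ i.+1 + -1 *: ((sigma - 1) ^+ j * sigma ^+ i).
    by rewrite scaleN1r !exprS; move: ((sigma - 1) ^+ j) (sigma ^+ i) => A B; ring.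
  by rewrite actD actZ mulN1r.
have dhX j : (sigma - 1) ^+ j = ('X - 1) ^+ j * tau ^+ j by rewrite sigma1 exprMn.
exists h => [k Kk|].
  by rewrite -[k in LHS]mulg1 -(expg0 t) hE // expr0 act1.
split; last first.
  move=> j; apply: (@polynomial_ext _ _ _ _ sK _ (act c (('X - 1) ^+ j * tau ^+ j) f)).
    by move=> k Kk; rewrite -[k in RHS]mulg1 -(expg0 t) dh // expr0 mulr1 dhX.
  by apply: (polynomial_act_Xn fM sK KM1) => //; exact: KM.
exists r => x /adjoin_finite[k [i [Kk ->]]]; rewrite dh // dhX -mulrA.
apply: polynomial0 Kk; rewrite (_ : 0%N = (r - r * s)%N); last by nia.
by apply: (polynomial_act_Xn fM sK KM1) => //; exact: KM.
Qed.

End FiniteOrder.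

Lemma exists_min_power : (exists2 n, (0 < n)%N & K (t ^+ n)%g) ->
  exists n, [/\ (0 < n)%N, K (t ^+ n)%g & forall i, K (t ^+ i)%g -> (n %| i)%N].
Proof.
move=> [m m0 Km]; pose Pn n := `[< (0 < n)%N /\ K (t ^+ n)%g >].
have ex : exists n, Pn n by exists m; apply/asboolP.
case: (ex_minnP ex) => n /asboolP[n0 Kn] n_min; exists n; split=> // i Ki.
rewrite /dvdn; have [//|in0] := posnP (i %% n).
suff /n_min : Pn (i %% n)%N by rewrite leqNgt ltn_pmod.
apply/asboolP; split=> //; rewrite (_ : t ^+ (i %% n) = (t ^+ n ^+ (i %/ n))^-1 ** t ^+ i)%g.
  by apply: (subgroupM sK) => //; apply: (subgroupV sK); apply: (subgroupX _ sK).
by rewrite {3}(divn_eq i n) expgnDr mulnC expgnA mulKg.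
Qed.

Section PrimeOrder.
Hypotheses (pp : prime p) (charp : p \in [pchar F]) (nKt : ~ K t).

Let Ktp : K (t ^+ p)%g.
Proof.
apply: MK; apply: (fil_le fM _ (fil_pow fM s0 Mt)).
by rewrite ltnS leq_pmull // prime_gt0.
Qed.

Let p_min i : K (t ^+ i)%g -> (p %| i)%N.
Proof.
have [|n [n0 Kn n_min]] := exists_min_power; first by exists p => //; exact: prime_gt0.
have := n_min _ Ktp; move: (pp) => /primeP[_ np] /np/orP[/eqP n1|/eqP <-]; last exact: n_min.
by case: nKt; rewrite n1 expg1 in Kn.
Qed.

Let adjoin_prime x : adjoin x -> exists k i, [/\ K k, (i < p)%N & x = (k ** t ^+ i)%g].
Proof.
have p0 := prime_gt0 pp.
move=> /(adjoin_finite p0 Ktp)[k [i [Kk ->]]].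
exists (k ** t ^+ (p * (i %/ p)))%g, (i %% p)%N; split; last 1 first.
- by rewrite -mulgA -expgnDr mulnC -divn_eq.
- by apply: (subgroupM sK) => //; rewrite expgnA; apply: (subgroupX _ sK).
- by rewrite ltn_pmod.
Qed.

Lemma iter_rdiff_const f e m k : (forall i, (i <= m)%N -> f (k ** t ^+ i)%g = e) ->
  (0 < m)%N -> iter m (rdiff t) f k = 0.
Proof.
case: m => // m fe _; rewrite iterSr.
have : forall i, (i <= m)%N -> rdiff t f (k ** t ^+ i)%g = 0.
  move=> i im; rewrite /rdiff -mulgA -expgSr !fe ?subrr //; exact: leqW.
elim: m (rdiff t f) {fe} => [|m IHm] g g0.
  by have := g0 0%N (leqnn _); rewrite expg0 mulg1.
rewrite iterSr; apply: IHm => i im.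
by rewrite /rdiff -mulgA -expgSr !g0 ?subrr //; exact: leqW.
Qed.

(** The extension is constant on [k], [k * t], ..., [k * t ^+ p.-1]. In
    characteristic [p] the [p]-th difference in the direction of [t] is the
    difference in the direction of [t ^+ p]; as [t ^+ p] lies deeper than level
    [p * s], the order drops by [s] for each step on average. *)
Lemma extend_prime r f : P r f -> exists2 h, forall k, K k -> h k = f k & Q r h.
Proof.
move=> Pf; have p0 := prime_gt0 pp; set c := (t ^+ p)%g.
have Kc y : K y -> K (y ** c) by move=> Ky; apply: (subgroupM sK).
have [|h hE] := @adjoin_fun_finite p p_min
    (fun k i => f (k ** t ^+ (p * (i %/ p)))%g).
  move=> k i m Kk; rewrite divnDr ?dvdn_mulr // mulKn // mulnDr expgnDr mulgA.
  by rewrite -!mulgA -!expgnDr addnC.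
have hi k i : K k -> (i < p)%N -> h (k ** t ^+ i)%g = f k.
  by move=> Kk ip; rewrite hE // divn_small // muln0 expg0 mulg1.
have XpE : ('X - 1) ^+ p = 'X^p - 1 :> {poly F}.
  have pX : p \in [pchar {poly F}] by rewrite pchar_poly.
  by rewrite -(pFrobenius_autE pX) rmorphB rmorph1 /= pFrobenius_autE.
have actXn m g y : act t 'X^m g y = g (y ** t ^+ m)%g.
  elim: m g y => [|m IHm] g y; first by rewrite expr0 act1 expg0 mulg1.
  by rewrite exprSr actMX IHm expgSr mulgA.
have hp a k i : K k -> (i < p)%N ->
    iter (p * a) (rdiff t) h (k ** t ^+ i)%g = iter a (rdiff c) f k.
  elim: a k i => [|a IHa] k i Kk ip; first by rewrite muln0 /= hi.
  rewrite mulnS iterD iter_rdiff XpE -scaleN1r actD actZ act1 mulN1r actXn.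
  rewrite -mulgA -expgnDr addnC expgnDr mulgA !IHa //; exact: Kc.
have Mc : M (p * s).+1 c by apply: (fil_pow fM).
have PfR a : P (r - a * (p * s).+1) (iter a (rdiff c) f).
  exact: (polynomial_iter_rdiff fM sK KM1).
exists h => [k Kk|].
  by rewrite -[k in LHS]mulg1 -(expg0 t) hi.
split.
  exists (p * r)%N => x /adjoin_prime[k [i [Kk ip ->]]]; rewrite hp //.
  apply: (polynomial0 _ Kk); rewrite (_ : 0%N = (r - r * (p * s).+1)%N) //; nia.
move=> j; case: (posnP (j %% p)) => jp; last first.
  apply: (polynomial_zero sK) => k Kk; rewrite (divn_eq j p) addnC iterD mulnC.
  apply: (iter_rdiff_const (e := iter (j %/ p) (rdiff c) f k)) => // i ij.
  by rewrite hp //; apply: leq_ltn_trans ij _; rewrite ltn_pmod.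
have jE : (j = p * (j %/ p))%N by rewrite mulnC {1}(divn_eq j p) jp addn0.
apply: (@polynomial_ext _ _ _ _ sK _ (iter (j %/ p) (rdiff c) f)).
  by move=> k Kk; rewrite -[k in RHS]mulg1 -(expg0 t) [in RHS]jE hp.
by apply: polynomial_le (PfR (j %/ p)%N); move: jE; move: (j %/ p)%N => a ->; nia.
Qed.

Lemma coordinate_prime r : (s < r)%N ->
  exists h, [/\ forall k, K k -> h k = 0, h t = 1 & Q r h].
Proof.
move=> sr; have p0 := prime_gt0 pp.
have [|h hE] := @adjoin_fun_finite p p_min (fun _ i => i%:R).
  by move=> k i m _; rewrite natrD natrM (pcharf0 charp) mul0r addr0.
have hK k : K k -> h k = 0 by move=> Kk; rewrite -[k]mulg1 -(expg0 t) hE.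
have dh x : adjoin x -> rdiff t h x = 1.
  move=> /adjoin_prime[k [i [Kk _ ->]]].
  by rewrite /rdiff -mulgA -expgSr !hE // -natr1; ring.
exists h; split=> //.
  by rewrite -[t in LHS]mul1g -(expg1 t) hE //; exact: (subgroup1 sK).
exact: affine_adjoin_poly.
Qed.

End PrimeOrder.

End CyclicExtension.

Local Open Scope ring_scope.

(** * Extension through the levels *)
Section Roots.
Variable F : fieldType.

Lemma expr_add_quadratic (A : comPzRingType) (a b : A) n :
  exists w, (a + b) ^+ n.+1 = a ^+ n.+1 + n.+1%:R * a ^+ n * b + b ^+ 2 * w.
Proof.
elim: n => [|n [w IHn]]; first by exists 0; rewrite !expr1 expr0; ring.
exists ((a + b) * w + n.+1%:R * a ^+ n).
by rewrite exprS IHn !exprS -natr1; move: (a ^+ n) => an; ring.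
Qed.

(** Successive approximation: a root modulo [('X - 1) ^+ m] is corrected by a
    multiple of that power, since [n] is invertible. *)
Lemma poly_root_X n m : (0 < n)%N -> n%:R != 0 :> F ->
  exists sigma tau u : {poly F},
    sigma ^+ n = 'X + ('X - 1) ^+ m * u /\ sigma - 1 = ('X - 1) * tau.
Proof.
case: n => // n _ n0.
suff [s [q [u [sn s1]]]] : exists sigma tau u : {poly F},
    sigma ^+ n.+1 = 'X + ('X - 1) ^+ m.+1 * u /\ sigma - 1 = ('X - 1) * tau.
  by exists s, q, (('X - 1) * u); rewrite mulrA -exprSr.
elim: m => [|m [s [q [u [sn s1]]]]].
  by exists 1, 0, (-1); rewrite expr1n expr1; split; ring.
pose c := u.[1] / n.+1%:R; pose h := c *: ('X - 1) ^+ m.+1 : {poly F}.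
have [w sw] := expr_add_quadratic s (- h) n.
have sat1 : s.[1] = 1.
  by have := congr1 (horner^~ 1) s1; rewrite !hornerE subrr mul0r => /eqP;
    rewrite subr_eq0 => /eqP.
have /factor_theorem[v vE] : root (u - u.[1] *: s ^+ n) 1.
  by rewrite /root !hornerE sat1 expr1n mulr1 subrr.
rewrite polyC1 in vE.
exists (s - h), (q - c *: ('X - 1) ^+ m), (v + c *: (c *: (('X - 1) ^+ m * w))).
split; last first.
  rewrite addrAC s1 /h exprS -!mul_polyC; move: (('X - 1) ^+ m) => A; ring.
have cn : (u.[1])%:P = n.+1%:R * c%:P :> {poly F}.
  by rewrite -(rmorph_nat polyC) -polyCM /c mulrC divfK.
have uE : u = v * ('X - 1) + n.+1%:R * c%:P * s ^+ n.
  by rewrite -cn mul_polyC -vE subrK.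
rewrite sw sn {1}uE /h -!mul_polyC !exprS.
by move: (('X - 1) ^+ m) (s ^+ n) n.+1%:R c%:P => A S N C; ring.
Qed.

End Roots.

Section Extension.
Variables (G : groupType) (F : fieldType).
Variables (p : nat) (M : nat -> set G) (R : nat).
Hypothesis fM : filtration p M R.
Hypothesis charF : (p = 0%N /\ forall n, (0 < n)%N -> n%:R != 0 :> F) \/
                   (prime p /\ p \in [pchar F]).
Implicit Types (f h : G -> F) (K : set G).

Lemma extend_cyclic K s t r f : subgroup K -> M s.+1 `<=` K -> K `<=` M s ->
  (0 < s)%N -> M s t -> ~ K t -> polynomial_on M K r f ->
  exists2 h, forall k, K k -> h k = f k & polynomial_on M (adjoin K t) r h.
Proof.
move=> sK MK KM s0 Mt nKt Pf.
suff [h hf Qh] : exists2 h, forall k, K k -> h k = f k & adjoin_poly M K s t r h.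
  by exists h => //; apply: (adjoin_polyP fM sK MK KM s0 Mt Qh).
have [fin|/forall2NP inf] := pselect (exists2 n, (0 < n)%N & K (t ^+ n)%g); last first.
  apply: (extend_infinite fM sK MK KM s0 Mt _ Pf) => n n0.
  by case: (inf n) => // /negP; rewrite n0.
case: charF => [[_ char0]|[pp charp]].
  have [n [n0 Kn n_min]] := exists_min_power sK fin.
  have [sigma [tau [u [e1 e2]]]] := poly_root_X r n0 (char0 _ n0).
  exact: (extend_root fM sK KM s0 n0 Kn n_min e1 e2 Pf).
exact: (extend_prime fM sK MK KM s0 Mt pp charp nKt Pf).
Qed.

Section Level.
Variables (K0 : set G) (s r : nat) (f : G -> F).
Hypotheses (sK0 : subgroup K0) (MK0 : M s.+1 `<=` K0) (K0M : K0 `<=` M s).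
Hypotheses (s0 : (0 < s)%N) (Pf : polynomial_on M K0 r f).

Let extension (e : set G * (G -> F)) : Prop :=
  [/\ subgroup e.1, K0 `<=` e.1, e.1 `<=` M s, polynomial_on M e.1 r e.2 &
      forall k, K0 k -> e.2 k = f k].

Let extends (e e' : {e | extension e}) : bool :=
  `[< (sval e).1 `<=` (sval e').1 /\
      forall k, (sval e).1 k -> (sval e').2 k = (sval e).2 k >].

Let extension_chain (A : set {e | extension e}) : total_on A extends ->
  exists u, forall e, A e -> extends e u.
Proof.
move=> totA.
have e0P : extension (K0, f) by split.
have [[a Aa]|] := pselect (A !=set0); last first.
  move=> A0; exists (exist _ _ e0P) => e Ae; case: A0; by exists e.
pose K := \bigcup_(e in A) (sval e).1.
pose h x := xget 0 [set y | exists2 e, A e & (sval e).1 x /\ y = (sval e).2 x].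
have hE e x : A e -> (sval e).1 x -> h x = (sval e).2 x.
  move=> Ae ex; rewrite /h; case: xgetP => [y _ [e' Ae' [e'x ->]]|]; last first.
    by move=> /(_ ((sval e).2 x))[]; exists e.
  by have [/asboolP[_ ->]|/asboolP[_ <-]] := totA _ _ Ae Ae'.
have fin (l : seq G) : (forall x, x \in l -> K x) ->
    exists2 e, A e & forall x, x \in l -> (sval e).1 x.
  elim: l => [|x l IHl] Kl; first by exists a.
  have [|e Ae el] := IHl; first by move=> z zl; apply: Kl; rewrite inE zl orbT.
  have [e' Ae' e'x] : K x by apply: Kl; exact: mem_head.
  have [/asboolP[ee' _]|/asboolP[e'e _]] := totA _ _ Ae Ae'.
    by exists e' => // z; rewrite inE => /predU1P[->//|/el/ee'].
  by exists e => // z; rewrite inE => /predU1P[->|/el//]; exact: e'e.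
have KhP : extension (K, h).
  split=> /=.
  - apply/subgroupP; split.
    + by exists a => //; case: (svalP a) => /subgroup1.
    + move=> x y Kx Ky; have [|e Ae exy] := fin [:: x; y].
        by move=> z; rewrite !inE => /orP[]/eqP ->.
      have [se _ _ _ _] := svalP e; exists e => //.
      by apply: (subgroupM se); apply: exy; rewrite !inE eqxx ?orbT.
    + move=> x [e Ae ex]; exists e => //; have [se _ _ _ _] := svalP e.
      exact: (subgroupV se).
  - by move=> k K0k; exists a => //; case: (svalP a) => _ + _ _ _; apply.
  - by move=> k [e Ae ek]; case: (svalP e) => _ _ + _ _; apply.
  - move=> l Kl hl y Ky; have [|e Ae eyl] := fin (y :: l).
      by move=> z; rewrite inE => /predU1P[->|/Kl].
    have [se _ _ Pe _] := svalP e.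
    have el x : x \in l -> (sval e).1 x by move=> xl; apply: eyl; rewrite inE xl orbT.
    have ey : (sval e).1 y by apply: eyl; exact: mem_head.
    by rewrite (@ldiffs_ext _ _ _ se l h (sval e).2) ?Pe // => x; exact: hE.
  - move=> k K0k; have [se K0e _ _ ef] := svalP a.
    by rewrite (hE _ _ Aa) ?ef //; exact: K0e.
exists (exist _ _ KhP) => e Ae; apply/asboolP; split=> /= [x ex|x]; first by exists e.
exact: hE.
Qed.

Lemma extend_level :
  exists2 h, forall k, K0 k -> h k = f k & polynomial_on M (M s) r h.
Proof.
have e0P : extension (K0, f) by split.
have [|e1 e2 e3 /asboolP[i1 h1] /asboolP[i2 h2]|e emax] :=
  @ZL_preorder _ (exist _ _ e0P) extends _ _ extension_chain.
- by move=> e; apply/asboolP; split.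
- apply/asboolP; split=> [|k e1k]; first exact: subset_trans i2.
  by rewrite h2 ?h1 //; exact: i1.
case: e emax => [[K h] /= Kh] emax; have [/= sK K0K KMs Ph hf] := Kh.
suff MsK : M s `<=` K by exists h => //; rewrite (_ : M s = K) //; apply/seteqP.
move=> t Mt; apply: contrapT => nKt.
have MK : M s.+1 `<=` K by exact: subset_trans K0K.
have [h' h'h Ph'] := extend_cyclic sK MK KMs s0 Mt nKt Ph.
have Kh' : extension (adjoin K t, h').
  split=> //=.
  - exact: (adjoin_subgroup fM sK MK KMs s0 Mt).
  - by move=> k /K0K; apply: sub_adjoin.
  - exact: (adjoin_sub fM KMs Mt).
  - by move=> k K0k; rewrite h'h ?hf //; exact: K0K.
have /emax/asboolP[/= sub _] : extends (exist _ _ Kh) (exist _ _ Kh').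
  by apply/asboolP; split=> //=; exact: sub_adjoin.
by apply: nKt; apply: sub; exact: mem_adjoin.
Qed.

End Level.

Lemma extend_to_top s r f : polynomial_on M (M s.+1) r f ->
  exists2 h, forall k, M s.+1 k -> h k = f k & polynomial_on M (M 1%N) r h.
Proof.
elim: s f => [|s IHs] f Pf; first by exists f.
have [|//||//|h hf Ph] := extend_level (s := s.+1) _ _ _ _ Pf.
- exact: (normal_sub (fil_normal fM _)).
- exact: (fil_desc fM).
have [h' h'h Ph'] := IHs _ Ph; exists h' => // k Mk.
by rewrite h'h ?hf //; exact: (fil_desc fM).
Qed.

(** Modulo the next level [g] has infinite order by hypothesis, or prime order
    [p] by [fil_pow]; so its exponent is a coordinate with values in [F]. *)
Lemma polynomial_separation s g : (0 < s)%N -> M s g -> ~ M s.+1 g ->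
  (p = 0%N -> forall n, (0 < n)%N -> ~ M s.+1 (g ^+ n)%g) ->
  exists h, [/\ h 1%g = 0, h g = 1 & polynomial_on M (M 1%N) R h].
Proof.
move=> s0 Mg nMg g_inf; set K := M s.+1.
have sK : subgroup K by exact: (normal_sub (fil_normal fM _)).
have MK : M s.+1 `<=` K by [].
have KM : K `<=` M s by exact: (fil_desc fM).
have sR : (s < R)%N.
  rewrite ltnNge; apply/negP => Rs; apply: nMg.
  by rewrite (fil_last fM (fil_le fM Rs Mg)); exact: (subgroup1 sK).
have [h0 [h0K h0g Qh0]] : exists h, [/\ forall k, K k -> h k = 0, h g = 1 &
    adjoin_poly M K s g R h].
  case: charF => [[p0 _]|[pp charp]].
    exact: (coordinate_infinite F fM sK MK KM s0 Mg (g_inf p0) sR).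
  exact: (coordinate_prime fM sK MK KM s0 Mg pp charp nMg sR).
have Ph0 := adjoin_polyP fM sK MK KM s0 Mg Qh0.
have [h1 h1h Ph1] := extend_level (adjoin_subgroup fM sK MK KM s0 Mg)
  (subset_trans MK (@sub_adjoin _ K g)) (adjoin_sub fM KM Mg) s0 Ph0.
have [h2 h2h Ph2] : exists2 h, forall k, M s k -> h k = h1 k &
    polynomial_on M (M 1%N) R h.
  by case: (s) s0 Ph1 => // s' _; apply: extend_to_top.
have M1 : M s 1%g by exact: (subgroup1 (normal_sub (fil_normal fM _))).
exists h2; split=> //.
- rewrite h2h // h1h ?h0K //; first exact: (subgroup1 sK).
  by apply: sub_adjoin; exact: (subgroup1 sK).
- by rewrite h2h // h1h //; exact: mem_adjoin.
Qed.

End Extension.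

(** * Series and stabilisers of finite chains *)

Section Series.
Variables (F : fieldType) (V : lmodType F).
Implicit Types (W B T : set V) (L : set (set V)) (g h : GL V).

Lemma subspaceP W : subspace W <-> W 0 /\ forall a u v, W u -> W v -> W (a *: u + v).
Proof.
split=> [[W0 cW]|[W0 cW]]; split; first exact/set_mem.
- by move=> a u v /mem_set Wu /mem_set Wv; apply/set_mem; apply: cW.
- exact/mem_set.
- by move=> a u v /set_mem Wu /set_mem Wv; apply/mem_set; apply: cW.
Qed.

Lemma subspace0 W : subspace W -> W 0.
Proof. by move=> /subspaceP[]. Qed.

Lemma subspaceB W u v : subspace W -> W u -> W v -> W (u - v).
Proof. by move=> sW Wu Wv; apply: subspaceD => //; apply: subspaceN. Qed.

Lemma bigcap_subspace L : (forall W, L W -> subspace W) ->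
  subspace (\bigcap_(W in L) W).
Proof.
move=> sL; apply/subspaceP; split=> [W LW|a u v Lu Lv W LW].
  exact: (subspace0 (sL W LW)).
by have /subspaceP[_] := sL W LW; apply; [exact: Lu|exact: Lv].
Qed.

Lemma bigcup_subspace L : (forall W, L W -> subspace W) -> L !=set0 ->
  (forall W1 W2, L W1 -> L W2 -> W1 `<=` W2 \/ W2 `<=` W1) ->
  subspace (\bigcup_(W in L) W).
Proof.
move=> sL [W0 LW0] tL; apply/subspaceP; split.
  by exists W0 => //; exact: (subspace0 (sL _ LW0)).
move=> a u v [W1 LW1 W1u] [W2 LW2 W2v].
case: (tL _ _ LW1 LW2) => sW; [exists W2|exists W1] => //.
  by have /subspaceP[_] := sL _ LW2; apply => //; exact: sW.
by have /subspaceP[_] := sL _ LW1; apply => //; exact: sW.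
Qed.

(** By maximality a maximal chain of subspaces is closed under unions and
    intersections of subfamilies. *)
Lemma series_extension L0 :
  (forall W, L0 W -> subspace W) ->
  (forall W1 W2, L0 W1 -> L0 W2 -> W1 `<=` W2 \/ W2 `<=` W1) ->
  exists2 L, L0 `<=` L & is_series L.
Proof.
move=> sL0 tL0.
pose P L := (forall W, (L0 `|` L) W -> subspace W) /\
  (forall W1 W2, (L0 `|` L) W1 -> (L0 `|` L) W2 -> W1 `<=` W2 \/ W2 `<=` W1).
have [C CP totC|A [[sA tA] maxA]] := @Zorn_bigcup _ P.
  split=> [W [/sL0//|[L CL LW]]|W1 W2]; first by apply: (CP _ CL).1; right.
  move=> [L1|[C1 CC1 C1W1]] [L2|[C2 CC2 C2W2]].
  - exact: tL0.
  - by apply: (CP _ CC2).2; [left|right].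
  - by apply: (CP _ CC1).2; [right|left].
  - case: (totC _ _ CC1 CC2) => sC.
      by apply: (CP _ CC2).2; right => //; exact: sC.
    by apply: (CP _ CC1).2; right => //; exact: sC.
pose L := L0 `|` A; exists L; first exact: subsetUl.
have maxL W : subspace W -> (forall W', L W' -> W `<=` W' \/ W' `<=` W) -> L W.
  move=> sW tW; right; apply: contrapT => nAW.
  apply: (maxA (W |` A)); first split; first by move=> U AU; right.
    by move=> /(_ W) nW; apply: nAW; apply: nW; left.
  split=> [U|U1 U2].
    by move=> [L0U|[->//|AU]]; apply: sA; [left|right].
  have key U : (L0 `|` (W |` A)) U -> U = W \/ L U.
    by move=> [L0U|[->|AU]]; [right; left|left|right; right].
  move=> /key[->|LU1] /key[->|LU2].
  - by left.
  - exact: tW.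
  - by case: (tW _ LU1); [right|left].
  - exact: tA.
split=> //.
- apply: maxL => [|W LW].
    by apply/subspaceP; split=> // a u v -> ->; rewrite scaler0 addr0.
  by left=> v ->; exact: (subspace0 (sA _ LW)).
- by apply: maxL => [|W LW]; [apply/subspaceP|right].
- move=> FF FL; apply: maxL => [|W LW].
    by apply: bigcap_subspace => W /FL; exact: sA.
  have [[W' [FW' sW']]|nF] := pselect (exists W', FF W' /\ W' `<=` W).
    by left=> v /(_ W' FW')/sW'.
  right=> v Wv W' FW'; case: (tA _ _ LW (FL _ FW')) => [|sW']; first by apply.
  by case: nF; exists W'.
- move=> FF FL F0; apply: maxL => [|W LW].
    apply: bigcup_subspace => // [W /FL|W1 W2 /FL L1 /FL L2]; first exact: sA.
    exact: tA.
  have [[W' [FW' sW']]|nF] := pselect (exists W', FF W' /\ W `<=` W').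
    by right=> v Wv; exists W' => //; exact: sW'.
  left=> v [W' FW' W'v]; case: (tA _ _ LW (FL _ FW')) => [sW'|]; last by apply.
  by case: nF; exists W'.
Qed.

(** A vector [v] of [W] is moved within the lower member of its own jump, and
    that member lies in [W] as it does not contain [v]. *)
Lemma stability_group_stable L g W v : is_series L -> stability_group L g ->
  L W -> W v -> W (g v).
Proof.
move=> sL Sg LW Wv; have [->|v0] := eqVneq v 0.
  by rewrite linear0; apply: (subspace0 (series_subspace sL LW)).
have [B [T [j Tv nBv _]]] := series_jump sL v0.
have BW : B `<=` W.
  have [LB _ _ _] := j; case: (series_total sL LB LW) => // WB.
  by case: nBv; exact: WB.
rewrite -(subrK v (g v)); apply: subspaceD => //; first exact: (series_subspace sL LW).
by apply: BW; apply: (Sg _ _ j); exists v.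
Qed.

Section FiniteChain.
Variables (L : set (set V)) (W : nat -> set V) (n : nat).
Hypotheses (sL : is_series L) (LW : forall i, L (W i)).
Hypotheses (W0 : W 0%N `<=` [set 0]) (Wn : forall i v, (n <= i)%N -> W i v).

Definition chain_stabilizer : set (GL V) :=
  [set g | stability_group L g /\ forall i v, W i.+1 v -> W i (g v - v)].

Let sS := stability_group_subgroup sL.
Let sW i : subspace (W i). Proof. exact: (series_subspace sL). Qed.
Let SW g i v : stability_group L g -> W i v -> W i (g v).
Proof. by move=> Sg; exact: (stability_group_stable sL Sg (LW i)). Qed.
Let SWV g i v : stability_group L g -> W i v -> W i (gl_inv g v).
Proof. by move=> Sg; apply: (@SW (g^-1)%g); apply: (subgroupV sS). Qed.

Let stab j : set (GL V) :=
  [set g | stability_group L g /\ forall i v, W (i + j) v -> W i (g v - v)].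

Let stab_subgroup j : subgroup (stab j).
Proof.
apply/subgroupP; split.
- split=> [|i v _ /=]; first exact: (subgroup1 sS).
  by rewrite subrr; apply: (subspace0 (sW _)).
- move=> g h [Sg Wg] [Sh Wh]; split; first exact: (subgroupM sS).
  move=> i v Wv /=.
  rewrite -(subrK (g v) (h (g v))) -addrA; apply: subspaceD => //; last exact: Wg.
  by apply: Wh; exact: SW.
- move=> g [Sg Wg]; split; first exact: (subgroupV sS).
  move=> i v Wv /=; rewrite -{2}(gl_invK g v) -opprB; apply: subspaceN => //.
  by apply: Wg; exact: SWV.
Qed.

Lemma chain_stabilizer_normal :
  normal_subgroup (stability_group L) chain_stabilizer.
Proof.
have stab1 : chain_stabilizer = stab 1.
  by apply/seteqP; split=> g [Sg Wg]; split=> // i v;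
    [rewrite addn1|rewrite -addn1]; exact: Wg.
split=> [|g []//|g h [Sg Wg] Sh]; first by rewrite stab1; exact: stab_subgroup.
split=> [|i v Wv /=].
  by apply: (subgroupM sS); [apply: (subgroupV sS)|apply: (subgroupM sS)].
rewrite -{2}(gl_invK h v) -linearB; apply: SW => //.
by apply: Wg; exact: SWV.
Qed.

(** If [g - 1] pushes the chain down by [i] steps and [h - 1] by [j] steps, then
    [gh - hg = (g - 1)(h - 1) - (h - 1)(g - 1)] pushes it down by [i + j]. *)
Lemma chain_stabilizer_nilpotent : nilpotent chain_stabilizer.
Proof.
suff lcs m : lower_central chain_stabilizer m `<=` stab m.+1.
  exists n => g /lcs[_ Wg]; apply: gl_ext => v; apply/eqP; rewrite -subr_eq0.
  by apply/eqP/W0; apply: Wg; apply: Wn; rewrite add0n.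
elim: m => [|m IHm]; first by move=> g [Sg Wg]; split=> // i v; rewrite addn1; exact: Wg.
apply: generated_min; first exact: stab_subgroup.
move=> _ [g /IHm[Sg Wg] [h [Sh Wh] <-]]; split=> [|i v Wv /=].
  rewrite /commg /conjg; apply: (subgroupM sS); first exact: (subgroupV sS).
  by apply: (subgroupM sS); [apply: (subgroupV sS)|apply: (subgroupM sS)].
set u := gl_inv h (gl_inv g v).
have Wu : W (i + m.+2) u by do 2!apply: SWV => //.
have -> : h (g u) - v = (h (g u - u) - (g u - u)) - (g (h u - u) - (h u - u)).
  have {1}-> : v = g (h u) by rewrite /u !gl_invK.
  rewrite (linearB h) (linearB g) /=; move: (h (g u)) (g u) (h u) (g (h u)) => a b c d.
  by rewrite (opprB b) (opprB (d - b)) (opprB d) addrACA !subrKA.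
apply: subspaceB => //.
  by apply: Wh; apply: Wg; rewrite addSnnS.
apply: Wg; apply: Wh; by rewrite -addnS.
Qed.

Lemma chain_stabilizer_hirsch_plotkin :
  chain_stabilizer `<=` hirsch_plotkin_radical (stability_group L).
Proof.
move=> g Cg; apply: sub_generated; exists chain_stabilizer => //; split.
  exact: chain_stabilizer_normal.
move=> X XC _; apply: nilpotentS chain_stabilizer_nilpotent.
by apply: generated_min => //; case: chain_stabilizer_normal.
Qed.

End FiniteChain.
End Series.

(** * Refining chains of submodules *)

Section Modules.
Variables (G : groupType) (F : fieldType) (V : lmodType F).
Variable rho : {multiplicative G -> GL V}.
Implicit Types (N : set G) (W B T : set V) (x y : G) (v : V).

Definition submodule W := subspace W /\ forall x v, W v -> W (rho x v).

Fixpoint word_action (l : seq G) v : V :=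
  if l is x :: l' then word_action l' (rho x v - v) else v.

(** An ascending series between [B] and [T] on whose factors [N] acts
    trivially. *)
Fixpoint submodule_layer N B T e : set V :=
  if e is e'.+1 then
    [set v | T v /\ forall x, N x -> submodule_layer N B T e' (rho x v - v)]
  else B.

Let rhoM x y v : rho (x * y)%g v = rho y (rho x v).
Proof. by rewrite gmulfM. Qed.

Section Layer.
Variables (N : set G) (B T : set V).
Hypotheses (nN : normal N) (sB : submodule B) (sT : submodule T) (BT : B `<=` T).
Local Notation Y := (submodule_layer N B T).

Lemma submodule_layer_sub e : Y e `<=` T.
Proof. by case: e => [|e] // v []. Qed.

Lemma submodule_layerP e : submodule (Y e).
Proof.
elim: e => [//|e [sY Yx]]; have [sTs Tx] := sT.
split.
  apply/subspaceP; split=> [|a u v [Tu Yu] [Tv Yv]].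
    split=> [|x _]; first exact: subspace0.
    by rewrite linear0 subrr; exact: (subspace0 sY).
  split; first by have /subspaceP[_] := sTs; apply.
  move=> x Nx; rewrite linearP opprD addrACA -scalerBr.
  by have /subspaceP[_] := sY; apply; [exact: Yu|exact: Yv].
move=> x v [Tv Yv]; split=> [|y Ny]; first exact: Tx.
rewrite -rhoM (_ : (x * y)%g = (y ^ x^-1 * x)%g); last by rewrite -conjgCV.
by rewrite rhoM -linearB; apply: Yx; apply: Yv; exact: (normalJ _ nN).
Qed.

Lemma submodule_layerS e : Y e `<=` Y e.+1.
Proof.
elim: e => [|e IHe] v.
  move=> Bv; split=> [|x _]; first exact: BT.
  by have [sBs Bx] := sB; apply: subspaceB => //; exact: Bx.
by move=> [Tv Yv]; split=> // x Nx; apply: IHe; exact: Yv.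
Qed.

Lemma submodule_layer_full e :
  (forall l v, size l = e -> (forall x, x \in l -> N x) -> word_action l v = 0) ->
  T `<=` Y e.
Proof.
have [sTs Tx] := sT.
suff key d : forall v, T v -> (forall l, size l = d -> (forall x, x \in l -> N x) ->
    word_action l v = 0) -> Y d v.
  by move=> h v Tv; apply: key => // l le Nl; exact: h.
elim: d => [|d IHd] v Tv hv /=.
  by have := hv [::] erefl; move=> /= ->; [case: sB => /subspace0|].
split=> // x Nx; apply: IHd => [|l ld Nl].
  by apply: subspaceB => //; exact: Tx.
apply: (hv (x :: l)); first by rewrite /= ld.
by move=> z; rewrite inE => /predU1P[->|/Nl].
Qed.

End Layer.

Record module_chain (W : nat -> set V) (n : nat) : Prop := ModuleChain {
  mc_sub : forall i, submodule (W i);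
  mc_le : forall i, W i `<=` W i.+1;
  mc_first : W 0%N `<=` [set 0];
  mc_last : forall i v, (n <= i)%N -> W i v }.

(** Each step of the chain is subdivided into [e] steps, so that the original
    chain reappears at the multiples of [e]. *)
Definition refine_chain N e (W : nat -> set V) j :=
  submodule_layer N (W (j %/ e)%N) (W (j %/ e).+1%N) (j %% e)%N.

Lemma refine_chainP N e (W : nat -> set V) n : normal N -> (0 < e)%N ->
  (forall l v, size l = e -> (forall x, x \in l -> N x) -> word_action l v = 0) ->
  module_chain W n ->
  [/\ module_chain (refine_chain N e W) (n * e),
      forall i, refine_chain N e W (i * e) = W i &
      forall i x v, N x -> refine_chain N e W i.+1 v ->
        refine_chain N e W i (rho x v - v)].
Proof.
move=> nN e0 Ne cW.
have sW := mc_sub cW; have W_le := mc_le cW.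
have succ j : (j.+1 %/ e = j %/ e /\ j.+1 %% e = (j %% e).+1)%N \/
    [/\ j.+1 %/ e = (j %/ e).+1, j.+1 %% e = 0 & (j %% e).+1 = e]%N.
  have lt_e : (j %% e < e)%N by rewrite ltn_pmod.
  case: (ltngtP (j %% e).+1 e) => [lt|gt|eq]; [left|by lia|right].
    have jE : j.+1 = (j %/ e * e + (j %% e).+1)%N by rewrite addnS -divn_eq.
    by rewrite jE divnMDl // modnMDl (divn_small lt) (modn_small lt) addn0.
  have jE : j.+1 = ((j %/ e).+1 * e)%N.
    by rewrite mulSn addnC -[X in (_ + X)%N]eq addnS -divn_eq.
  by rewrite jE mulnK // modnMl.
have full i : W i.+1 `<=` submodule_layer N (W i) (W i.+1) e.
  exact: submodule_layer_full.
have multE i : refine_chain N e W (i * e) = W i.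
  by rewrite /refine_chain mulnK // modnMl.
split=> //; first split.
- by move=> j; apply: submodule_layerP.
- move=> j v; rewrite /refine_chain; case: (succ j) => [[-> ->]|[-> -> _]].
    exact: (submodule_layerS (sW _) (W_le _)).
  by move=> /submodule_layer_sub; apply.
- by rewrite -[0%N](mul0n e) multE; exact: mc_first cW.
- move=> j v nj; rewrite /refine_chain.
  have nje : (n <= j %/ e)%N by rewrite leq_divRL.
  have : submodule_layer N (W (j %/ e)%N) (W (j %/ e).+1%N) 0 v by exact: (mc_last cW).
  elim: (j %% e)%N => // d IHd /IHd; exact: (submodule_layerS (sW _) (W_le _)).
move=> j x v Nx; rewrite /refine_chain; case: (succ j) => [[-> ->] [_]|[-> -> je]].
  by apply.
move=> /= /(full (j %/ e)%N) fv.
have [_] : submodule_layer N (W (j %/ e)%N) (W (j %/ e).+1%N) (j %% e).+1 v.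
  by rewrite je.
by apply.
Qed.

Variables (N : nat -> set G) (R : nat -> nat).
Hypotheses (nN : forall k, normal (N k)) (R0 : forall k, (0 < R k)%N).
Hypothesis N_cover : forall x, exists k, N k x.
Hypothesis N_unip : forall k l v, size l = R k ->
  (forall x, x \in l -> N k x) -> word_action l v = 0.

Fixpoint chain_tower k : nat -> set V :=
  if k is k'.+1 then refine_chain (N k') (R k') (chain_tower k')
  else fun i => if i is 0%N then [set 0] else setT.

(** Refining the chain [0 < V] by each [N k] in turn gives chains, each finite
    and contained in the next; the one after step [k] is centralised by [N k]. *)
Theorem unipotent_embedding :
  exists2 L, is_series L &
    forall x, hirsch_plotkin_radical (stability_group L) (rho x).
Proof.
have cW k : exists n, module_chain (chain_tower k) n.
  elim: k => [|k [n cn]]; last first.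
    have [c _ _] := refine_chainP (nN k) (R0 k) (@N_unip k) cn.
    by exists (n * R k)%N.
  exists 1%N; split=> [[|i]|[|i]||[]] //.
    split; last by move=> x v ->; rewrite linear0.
    by apply/subspaceP; split=> // a u v -> ->; rewrite scaler0 addr0.
  by split=> //; apply/subspaceP.
pose L0 := [set W | exists k i, W = chain_tower k i].
have tower_le k k' i0 : (k <= k')%N ->
    exists i', chain_tower k i0 = chain_tower k' i'.
  elim: k' => [|k' IHk]; first by rewrite leqn0 => /eqP ->; exists i0.
  rewrite leq_eqVlt => /predU1P[->|/IHk[i' ->]]; first by exists i0.
  have [n cn] := cW k'; have [_ mE _] := refine_chainP (nN k') (R0 k') (@N_unip k') cn.
  by exists (i' * R k')%N; rewrite /= mE.
have [|W1 W2 [k1 [i1 ->]] [k2 [i2 ->]]|L L0L sL] := @series_extension _ V L0.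
- by move=> _ [k [i ->]]; have [n cn] := cW k; have [] := mc_sub cn i.
- have [i1' ->] := tower_le _ _ i1 (leq_maxl k1 k2).
  have [i2' ->] := tower_le _ _ i2 (leq_maxr k1 k2).
  have [n cn] := cW (maxn k1 k2).
  have mono i j : (i <= j)%N -> chain_tower (maxn k1 k2) i `<=` chain_tower (maxn k1 k2) j.
    elim: j => [|j IHj]; first by rewrite leqn0 => /eqP -> v.
    by rewrite leq_eqVlt => /predU1P[-> v //|/IHj Wij] v /Wij/(mc_le cn).
  by case: (leqP i1' i2') => [/mono|/ltnW/mono]; [left|right].
exists L => // x; have [k Nx] := N_cover x.
have LW k' i : L (chain_tower k' i) by apply: L0L; exists k', i.
have [n cn] := cW k.
have [cn' _ stab] := refine_chainP (nN k) (R0 k) (@N_unip k) cn.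
have moves i v : chain_tower k.+1 i.+1 v -> chain_tower k.+1 i (rho x v - v).
  exact: stab.
apply: (chain_stabilizer_hirsch_plotkin sL (LW k.+1) (mc_first cn') (mc_last cn')).
split; last by move=> i v; exact: moves.
move=> B T [LB LT [BT nTB] noW] _ [v Tv <-].
(* The chain meets the jump in a step [i], [i.+1] with [B] above the lower
   member and [T] below the upper one. *)
have [i [WiB WiT]] : exists i, chain_tower k.+1 i `<=` B /\ T `<=` chain_tower k.+1 i.+1.
  have WnB : ~ chain_tower k.+1 (n * R k)%N `<=` B.
    by move=> WB; apply: nTB => w _; apply: WB; exact: (mc_last cn').
  have W0B : chain_tower k.+1 0 `<=` B.
    by move=> w /(mc_first cn') ->; exact: (subspace0 (series_subspace sL LB)).
  have [i WiB nWiB] : exists2 i, chain_tower k.+1 i `<=` B & ~ chain_tower k.+1 i.+1 `<=` B.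
    elim: (n * R k)%N WnB => [//|m IHm] WmB.
    have [WB|] := pselect (chain_tower k.+1 m `<=` B); first by exists m.
    exact: IHm.
  exists i; split=> //; case: (series_total sL LT (LW k.+1 i.+1)) => // WT.
  case: (series_total sL LB (LW k.+1 i.+1)) => // BW.
  have [|nTW] := pselect (T `<=` chain_tower k.+1 i.+1); first exact.
  by case: (noW _ (LW k.+1 i.+1)).
by apply: WiB; apply: moves; exact: WiT.
Qed.

End Modules.

(** * The module of polynomial functions *)

Section PolynomialFunctions.
Variables (G : groupType) (F : fieldType) (H : set (seq G)).
Hypothesis HJ : forall l g, H l -> H [seq (x ^ g)%g | x <- l].

Definition annihilated : {pred G -> F^o} :=
  [pred f | `[< forall l, H l -> forall y, ldiffs l f y = 0 >]].

Lemma annihilatedP (f : G -> F) :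
  reflect (forall l, H l -> forall y, ldiffs l f y = 0) (f \in annihilated).
Proof. exact: asboolP. Qed.

Lemma annihilated_submod : submod_closed annihilated.
Proof.
have ldiffs0 l y : ldiffs l (0 : G -> F^o) y = 0.
  by rewrite -(mul0r (ldiffs l 0 y)) -ldiffsZ; congr (ldiffs l _ y);
    apply/funext => z; rewrite mul0r.
split=> [|a f h /annihilatedP Vf /annihilatedP Vh]; apply/annihilatedP => l Hl y.
  exact: ldiffs0.
rewrite (_ : a *: f + h = (fun z => a * f z + h z)) ?ldiffsD ?ldiffsZ //.
by rewrite Vf // Vh // mulr0 addr0.
Qed.
HB.instance Definition _ := 
  GRing.isSubmodClosed.Build F (G -> F^o) annihilated annihilated_submod.

Definition annihilated_fun := {f : G -> F^o | f \in annihilated}.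
HB.instance Definition _ := Choice.on annihilated_fun.
HB.instance Definition _ := SubChoice.on annihilated_fun.
HB.instance Definition _ :=
  [SubChoice_isSubLmodule of annihilated_fun by <:].

Lemma ldiffs_ltrans l (f : G -> F) x y :
  ldiffs l (fun z => f (x * z)%g) y = ldiffs [seq (a ^ x^-1)%g | a <- l] f (x * y)%g.
Proof.
elim: l f => //= a l IHl f; rewrite -IHl; congr (ldiffs l _ y).
by apply/funext => z; rewrite /ldiff !mulgA -conjgCV.
Qed.

Lemma translate_subproof x (v : annihilated_fun) :
  (fun z => val v (x * z)%g) \in annihilated.
Proof.
apply/annihilatedP => l Hl y; rewrite ldiffs_ltrans.
by apply: (annihilatedP _ (valP v)); apply: HJ.
Qed.

Definition translate x (v : annihilated_fun) : annihilated_fun :=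
  Sub (fun z => val v (x * z)%g) (translate_subproof x v).

Lemma translate_linear x : linear (translate x).
Proof. by move=> a u v; apply: val_inj; apply/funext => z. Qed.

Lemma translateK x : cancel (translate x) (translate x^-1%g).
Proof. by move=> v; apply: val_inj; apply/funext => z /=; rewrite mulVKg. Qed.

Lemma translateVK x : cancel (translate x^-1%g) (translate x).
Proof. by move=> v; apply: val_inj; apply/funext => z /=; rewrite mulKg. Qed.

Definition translation x : GL annihilated_fun :=
  MkGL (translate_linear x) (translateK x) (translateVK x).

Lemma translationM : {morph translation : x y / (x * y)%g >-> (x * y)%g}.
Proof.
move=> x y; apply: gl_ext => v; apply: val_inj; apply/funext => z /=.
by rewrite mulgA.
Qed.
HB.instance Definition _ := isMultiplicative.Build _ _ translation translationM.

Lemma val_word_action l v :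
  val (word_action translation l v) = ldiffs l (val v).
Proof. by elim: l v => //= x l IHl v; rewrite IHl. Qed.

End PolynomialFunctions.

(** * Towers of filtrations *)

Section Towers.
Variables (G : groupType) (p : nat).
Local Open Scope group_scope.

Definition refines (MR M'R' : (nat -> set G) * nat) (A : set G) : Prop :=
  [/\ M'R'.1 1%N = [set x | exists u v, [/\ MR.1 1%N u, A v & x = u * v]],
    exists2 q, (0 < q)%N & M'R'.1 q = MR.1 1%N,
    forall l, heavy MR.1 MR.2 l -> heavy M'R'.1 M'R'.2 l &
    forall l, (forall x, x \in l -> MR.1 1%N x) ->
      heavy M'R'.1 M'R'.2 l -> heavy MR.1 MR.2 l].

Lemma filtration_tower (A : nat -> set G) :
  (forall k, normal (A k)) -> (forall k, nilpotent (A k)) ->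
  (forall k, exists a, forall v, A k v -> v ^+ (p ^ a) = 1) ->
  exists MR : nat -> (nat -> set G) * nat,
    (forall k, filtration p (MR k).1 (MR k).2) /\
    (forall k, refines (MR k) (MR k.+1) (A k)).
Proof.
move=> nA nilA expA.
pose St := {MR : (nat -> set G) * nat | filtration p MR.1 MR.2}.
have step k (S : St) : {S' : St | refines (sval S) (sval S') (A k)}.
  apply/cid; have [M' [R' [q [fM' e1 [q0 eq] h1 h2]]]] :=
    filtration_refine (svalP S) (nA k) (nilA k) (expA k).
  by exists (exist _ (M', R') fM'); split=> //; exists q.
have f0 : filtration p (fun=> [set 1 : G]) 1.
  have s1 : subgroup [set 1 : G].
    by apply/subgroupP; split=> [//|x y -> ->|x ->]; rewrite ?mulg1 ?invg1.
  split=> // [i|i x //|i j x y _ _ -> ->|i x _ ->].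
  - by apply/normal_subgroupP; split=> // x g ->; rewrite conj1g.
  - by rewrite comm1g.
  - by rewrite expg1n.
pose st := fix st k : St :=
  if k is k'.+1 then sval (step k' (st k')) else exist _ (fun=> [set 1], 1%N) f0.
exists (fun k => sval (st k)); split=> k; first exact: (svalP (st k)).
exact: (svalP (step k (st k))).
Qed.

Section Tower.
Variables (A : nat -> set G) (MR : nat -> (nat -> set G) * nat).
Hypotheses (nA : forall k, normal (A k)).
Hypothesis (fMR : forall k, filtration p (MR k).1 (MR k).2).
Hypothesis (rMR : forall k, refines (MR k) (MR k.+1) (A k)).
Local Notation N k := ((MR k).1 1%N).

Lemma tower_le k k' : (k <= k')%N -> N k `<=` N k'.
Proof.
elim: k' => [|k' IHk]; first by rewrite leqn0 => /eqP -> x.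
rewrite leq_eqVlt => /predU1P[-> x //|/IHk Nkk] x /Nkk Nx.
have [-> _ _ _] := rMR k'; exists x, 1; rewrite mulg1; split=> //.
exact: (subgroup1 (normal_sub (nA k'))).
Qed.

Lemma tower_sub k : A k `<=` N k.+1.
Proof.
move=> x Ax; have [-> _ _ _] := rMR k; exists 1, x; rewrite mul1g; split=> //.
exact: (subgroup1 (normal_sub (fil_normal (fMR k) 1%N))).
Qed.

Lemma tower_heavy_le k k' l : (k <= k')%N ->
  heavy (MR k).1 (MR k).2 l -> heavy (MR k').1 (MR k').2 l.
Proof.
elim: k' => [|k' IHk]; first by rewrite leqn0 => /eqP ->.
rewrite leq_eqVlt => /predU1P[-> //|/IHk h /h].
by have [_ _ + _] := rMR k'; apply.
Qed.

Lemma tower_cover : (forall H, normal H -> (forall k, A k `<=` H) -> H = setT) ->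
  forall x, exists k, N k x.
Proof.
move=> Atop x; suff : (\bigcup_k N k) x by move=> [k _ Nx]; exists k.
have sN k : subgroup (N k) by exact: (normal_sub (fil_normal (fMR k) 1%N)).
rewrite (Atop (\bigcup_k N k)) // => [|k z Az]; last first.
  by exists k.+1 => //; exact: tower_sub.
apply/normal_subgroupP; split; last first.
  move=> z g [k _ Nz]; exists k => //.
  exact: (normalJ _ (fil_normal (fMR k) 1%N)).
apply/subgroupP; split.
- by exists 0%N => //; exact: (subgroup1 (sN _)).
- move=> y z [k _ Ny] [k' _ Nz]; exists (maxn k k') => //.
  apply: (subgroupM (sN _)); first exact: (tower_le (leq_maxl k k')).
  exact: (tower_le (leq_maxr k k')).
- by move=> y [k _ Ny]; exists k => //; exact: (subgroupV (sN _)).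
Qed.

Variable F : fieldType.
Hypothesis charF : (p = 0%N /\ forall n, (0 < n)%N -> (n%:R != 0 :> F)%R) \/
                   (prime p /\ p \in [pchar F]).

Lemma tower_extend_step k (f : G -> F) :
  polynomial_on (MR k).1 (N k) (MR k).2 f ->
  exists2 h, forall x, N k x -> h x = f x &
    polynomial_on (MR k.+1).1 (N k.+1) (MR k.+1).2 h.
Proof.
move=> Pf; have [_ [q q0 Mq] _ hN] := rMR k; rewrite -Mq in Pf hN *.
case: q q0 Pf hN {Mq} => // q _ Pf hN.
apply: (extend_to_top (fMR k.+1) charF) => l Nl hl y Ny.
by apply: (Pf l) => //; exact: hN.
Qed.

Definition tower_heavy : set (seq G) :=
  [set l | exists k, heavy (MR k).1 (MR k).2 l].

Hypothesis N_cover : forall x, exists k, N k x.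

Lemma heavy_sub k r l : heavy (MR k).1 r l -> forall x, x \in l -> N k x.
Proof.
elim: l r => [//|z l IHl] r /= [j j0 [Mz hl]] x; rewrite inE => /predU1P[->|].
  exact: (fil_le (fMR k) j0).
exact: IHl hl x.
Qed.

(** The extensions to successive stages agree where they overlap; a word that is
    heavy at one stage is heavy at all later ones, hence kills the limit. *)
Lemma tower_extend m (f : G -> F) :
  polynomial_on (MR m).1 (N m) (MR m).2 f ->
  exists2 h, forall x, N m x -> h x = f x & h \in @annihilated G F tower_heavy.
Proof.
move=> Pf.
pose P k h := polynomial_on (MR k).1 (N k) (MR k).2 (h : G -> F).
have step k h : {h' : G -> F | P k h -> (forall x, N k x -> h' x = h x) /\ P k.+1 h'}.
  apply/cid; have [/tower_extend_step[h' h'h Ph']|nP] := pselect (P k h).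
    by exists h'.
  by exists h.
pose hs := fix hs j := if j is j'.+1 then sval (step (m + j')%N (hs j')) else f.
have Phs j : P (m + j)%N (hs j).
  elim: j => [|j IHj]; first by rewrite addn0.
  by rewrite addnS; case: (svalP (step (m + j)%N (hs j)) IHj).
have hsS i j x : (i <= j)%N -> N (m + i) x -> hs j x = hs i x.
  move=> ij Nx; elim: j ij => [|j IHj]; first by rewrite leqn0 => /eqP ->.
  rewrite leq_eqVlt => /predU1P[-> //|ij]; rewrite -IHj //.
  case: (svalP (step (m + j)%N (hs j)) (Phs j)) => + _; apply.
  by apply: tower_le Nx; rewrite leq_add2l.
have N_cover' x : {j | N (m + j) x}.
  apply/cid; have [k Nx] := N_cover x; exists k; apply: tower_le Nx.
  exact: leq_addl.
pose h x := hs (sval (N_cover' x)) x.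
have hE j x : N (m + j) x -> h x = hs j x.
  move=> Nx; rewrite /h; case: (N_cover' x) => i /= Ni.
  by case: (leqP i j) => [ij|/ltnW ji]; [rewrite (hsS i j)|rewrite (hsS j i)].
exists h => [x Nx|]; first by rewrite (hE 0%N) ?addn0.
apply/annihilatedP => l [k hl] y; have [k' Ny] := N_cover y.
pose j := maxn k k'.
have kj : (k <= m + j)%N by apply: leq_trans (leq_addl _ _); exact: leq_maxl.
have Ny' : N (m + j) y.
  by apply: tower_le Ny; apply: leq_trans (leq_addl _ _); exact: leq_maxr.
have Nl x : x \in l -> N (m + j) x by move=> /(heavy_sub hl); exact: tower_le.
have sN := normal_sub (fil_normal (fMR (m + j)) 1%N).
rewrite (@ldiffs_ext _ _ _ sN l h (hs j)) //; last exact: hE.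
by apply: (Phs j) => //; exact: tower_heavy_le hl.
Qed.

Lemma tower_heavyJ l g : tower_heavy l -> tower_heavy [seq x ^ g | x <- l].
Proof.
move=> [k hl]; exists k; elim: l (MR k).2 hl => //= x l IHl r [j j0 [Mx hl]].
exists j => //; split; last exact: IHl.
exact: (normalJ _ (fil_normal (fMR k) j)).
Qed.

Local Notation V := (@annihilated_fun G F tower_heavy).
Local Notation rho := (@translation G F tower_heavy tower_heavyJ).

(** Every element of [N k] has level at least [1] at stage [k]. *)
Lemma tower_unipotent k l (v : V) : size l = (MR k).2 ->
  (forall x, x \in l -> N k x) -> word_action rho l v = 0%R.
Proof.
move=> sl Nl; apply: val_inj; rewrite val_word_action; apply/funext => y.
apply: (etrans (y := 0%R)) => [|//]; apply: (annihilatedP _ _ (valP v)); exists k; rewrite -sl.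
elim: l Nl {sl} => //= x l IHl Nl; exists 1%N => //; split.
  by apply: Nl; exact: mem_head.
by rewrite subSS subn0; apply: IHl => z zl; apply: Nl; rewrite inE zl orbT.
Qed.

(** The kernel would contain an element [g] of highest level; torsion-freeness
    keeps the powers of [g] out of the next level, so [g] is separated from the
    identity by a polynomial function. *)
Lemma tower_faithful : (p = 0%N -> torsion_free G) -> injective rho.
Proof.
move=> tfG x x' xx'.
pose C := [set g : G | forall f, f \in @annihilated G F tower_heavy ->
  forall y, f (g * y) = f y].
suff C1 g : C g -> g = 1.
  apply/divg1_eq/C1 => f Vf y.
  have := congr1 (fun h : GL V => val (h (Sub f Vf)) (x'^-1 * y)) xx'.
  by rewrite /= mulgA mulVKg.
have sC : subgroup C.
  apply/subgroupP; split=> [f Vf y|u v Cu Cv f Vf y|u Cu f Vf y].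
  - by rewrite mul1g.
  - by rewrite -mulgA Cu // Cv.
  - by rewrite -[in RHS](mulVKg u y) Cu.
move=> Cg; apply: contrapT => g1; have [k Nx] := N_cover g.
have fM := fMR k.
pose Q s := `[< (0 < s)%N /\ exists u, [/\ C u, u <> 1 & (MR k).1 s u] >].
have exQ : exists s, Q s by exists 1%N; apply/asboolP; split=> //; exists g.
have bQ s : Q s -> (s <= (MR k).2)%N.
  move=> /asboolP[s0 [u [_ u1 Mu]]]; rewrite leqNgt; apply/negP => /ltnW Rs.
  by apply: u1; apply: (fil_last fM); exact: (fil_le fM Rs).
case: (ex_maxnP exQ bQ) => s /asboolP[s0 [u [Cu u1 Mu]]] s_max.
have next v : C v -> (MR k).1 s.+1 v -> v = 1.
  move=> Cv Mv; apply: contrapT => v1.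
  have /s_max : Q s.+1 by apply/asboolP; split=> //; exists v.
  by rewrite ltnn.
have [|p0 n n0 Mun|h [h1 hu Ph]] := polynomial_separation fM charF s0 Mu.
- by move=> /(next _ Cu).
- by apply: u1; apply: (tfG p0 _ n n0); apply: next Mun; exact: (subgroupX _ sC).
have [f fh Vf] := tower_extend Ph.
have /eqP := Cu f Vf 1; rewrite mulg1 !fh ?h1 ?hu ?oner_eq0 //.
  exact: (subgroup1 (normal_sub (fil_normal fM _))).
exact: (fil_le fM s0).
Qed.

Lemma tower_embedding : (p = 0%N -> torsion_free G) ->
  exists (V : lmodType F) (L : set (set V)), is_series L /\
    exists2 f : {multiplicative G -> GL V}, injective f &
      forall x : G, hirsch_plotkin_radical (stability_group L) (f x).
Proof.
move=> tfG; exists V.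
have nN k : normal (N k) by exact: (fil_normal (fMR k)).
have R0 k : (0 < (MR k).2)%N by exact: (fil_gt0 (fMR k)).
have [L sL hL] := @unipotent_embedding G F V rho _ _ nN R0 N_cover tower_unipotent.
exists L; split=> //; exists (rho : {multiplicative G -> GL V}) => //.
exact: tower_faithful.
Qed.

End Tower.
End Towers.

(** * Countably generated Fitting groups *)

Section FittingGroups.
Variable G : groupType.
Local Open Scope group_scope.

Let U : set G := \bigcup_(N in [set N | normal N /\ nilpotent N]) N.

Lemma generated_finite (Y : set G) x : generated Y x ->
  exists l : seq G, (forall z, z \in l -> Y z) /\ generated [set` l] x.
Proof.
have sg (l : seq G) := @generated_subgroup G [set` l].
have gS (l l' : seq G) : {subset l <= l'} -> generated [set` l] `<=` generated [set` l'].
  by move=> ll'; apply: generatedS => z /ll'.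
apply: (@generated_min _ [set x | exists l : seq G,
  (forall z, z \in l -> Y z) /\ generated [set` l] x]).
  apply/subgroupP; split=> [|y z [l [Yl ly]] [l' [Yl' l'z]]|y [l [Yl ly]]].
  - by exists [::]; split=> //; exact: (subgroup1 (sg _)).
  - exists (l ++ l'); split.
      by move=> w; rewrite mem_cat => /orP[/Yl|/Yl'].
    apply: (subgroupM (sg _)); [apply: gS ly|apply: gS l'z] => w wl;
      by rewrite mem_cat wl ?orbT.
  - by exists l; split=> //; exact: (subgroupV (sg _)).
move=> y Yy; exists [:: y]; split=> [z|]; first by rewrite inE => /eqP ->.
by apply: sub_generated; rewrite /= inE.
Qed.

(** Each element of [X] is a product of finitely many elements of nilpotent
    normal subgroups and their inverses; [y] lists these factors for all of
    [X]. *)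
Lemma fitting_sequence (X : set G) : fitting_group G -> countable X ->
  normal_closure X = setT ->
  exists y : nat -> G, (forall k, nilpotent (normal_closure [set y k])) /\
    forall H, normal H -> (forall k, normal_closure [set y k] `<=` H) -> H = setT.
Proof.
move=> hF cX hX.
have U1 : U 1.
  exists [set 1] => //; split; last by exists 0%N.
  apply/normal_subgroupP; split=> [|x g ->]; last by rewrite conj1g.
  by apply/subgroupP; split=> [//|x z -> ->|x ->]; rewrite ?mulg1 ?invg1.
have lst x : {l : seq G | (forall z, z \in l -> U z) /\ generated [set` l] x}.
  by apply/cid/generated_finite; rewrite /U hF.
have [f finj] := countable_injP _ cX.
pose e n := xget 1 [set x | X x /\ f x = n].
have eX x : X x -> e (f x) = x.
  move=> Xx; rewrite /e; case: xgetP => [z _ [Xz fz]|/(_ x)[]//].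
  by apply: finj fz; exact: mem_set.
pose y k := if (unpickle k : option (nat * nat)) is Some (m, i)
  then nth 1 (sval (lst (e m))) i else 1.
have Uy k : U (y k).
  rewrite /y; case: unpickle => [[m i]|] //; case: (lst _) => l [Ul _] /=.
  by case: (ltnP i (size l)) => il; [apply: Ul; exact: mem_nth|rewrite nth_default].
exists y; split=> [k|H nH yH].
  have [N [nN nilN] Ny] := Uy k; apply: nilpotentS nilN.
  by apply: normal_closure_min => // z ->.
apply/seteqP; split=> // x _.
have : normal_closure X x by rewrite hX.
apply: (normal_closure_min nH) => z Xz; rewrite -(eX z Xz); move: (f z) => m.
have [_] := svalP (lst (e m)).
apply: (generated_min (normal_sub nH)) => w /(nthP 1)[i _ <-].
apply: (yH (pickle (m, i))); apply: sub_normal_closure.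
by rewrite /= /y pickleK.
Qed.

Lemma normal_closure_exponent (y : G) p a : y ^+ (p ^ a) = 1 ->
  nilpotent (normal_closure [set y]) ->
  exists b, forall x, normal_closure [set y] x -> x ^+ (p ^ b) = 1.
Proof.
move=> ya nil; have [|c cx] :=
  nilpotent_exponent (normal_closure_normal _) nil (n := (p ^ a)%N).
  by move=> _ [_ -> [g _ <-]]; rewrite -conjXg ya conj1g.
by exists (a * c)%N => x /cx; rewrite expnM.
Qed.

Lemma fitting_embedding (F : fieldType) p :
  ((p = 0%N /\ forall n, (0 < n)%N -> (n%:R != 0 :> F)%R) \/
   (prime p /\ p \in [pchar F])) ->
  (p = 0%N -> torsion_free G) -> (forall x : G, exists a, x ^+ (p ^ a) = 1) ->
  fitting_group G -> (exists2 X : set G, countable X & normal_closure X = setT) ->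
  exists (V : lmodType F) (L : set (set V)), is_series L /\
    exists2 f : {multiplicative G -> GL V}, injective f &
      forall x : G, hirsch_plotkin_radical (stability_group L) (f x).
Proof.
move=> charF tfG expG hF [X cX hX].
have [y [nil_y top_y]] := fitting_sequence hF cX hX.
have nA k : normal (normal_closure [set y k]) by exact: normal_closure_normal.
have expA k : exists a, forall v, normal_closure [set y k] v -> v ^+ (p ^ a) = 1.
  by have [a ya] := expG (y k); exact: normal_closure_exponent ya (nil_y k).
have [MR [fMR rMR]] := filtration_tower nA nil_y expA.
apply: (tower_embedding nA fMR rMR charF _ tfG).
exact: (tower_cover nA fMR rMR top_y).
Qed.

End FittingGroups.

Theorem theoremB (G : groupType) (hF : fitting_group G)
    (htp : torsion_free G \/ exists2 p : nat, prime p & p_group G p)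
    (hX : exists2 X : set G, countable X & normal_closure X = setT) :
  exists (F : fieldType) (V : lmodType F) (L : set (set V)),
    is_series L /\
    exists2 f : {multiplicative G -> GL V}, injective f &
      forall x : G, hirsch_plotkin_radical (stability_group L) (f x).
Proof.
case: htp => [tfG|[p pp pG]].
  exists rat; apply: (@fitting_embedding G rat 0) => //.
  - by left; split=> // n n0; rewrite Num.Theory.pnatr_eq0 -lt0n.
  - by move=> x; exists 1%N; rewrite expg0.
exists 'F_p; apply: (@fitting_embedding G 'F_p p) => //.
- by right; split=> //; exact: pchar_Fp.
- by move=> p0; rewrite p0 in pp.
Qed.
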